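(* Let $R$ be a Cohen-Macaulay local ring with canonical module $\omega_R$. Then $$\sqrt{\mathrm{Fitt}_1(\omega_R)}=\sqrt{\mathrm{tr}(\omega_R)}.$$
   Context: Local rings are Noetherian. For a finitely generated module $M$ over a Noetherian ring $R$, choose a finite free presentation $G\to F\to M\to 0$ with $\mathrm{rank}\,F=r$, and let $A$ be a matrix representing $G\to F$. The $j$th Fitting ideal of $M$ is $\mathrm{Fitt}_j(M)=I_{r-j}(A)$, where $I_t(A)$ is the ideal generated by the $t$-minors of $A$, with $I_t(A)=R$ for $t\le 0$. This is independent of the choices. The trace of an $R$-module $M$ is the ideal $\mathrm{tr}(M)=\sum_{\varphi\in \mathrm{Hom}_R(M,R)}\varphi(M)$. *)

(* Defs.v *)
From HB Require Import structures.
From mathcomp Require Import all_boot all_order all_algebra.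
From mathcomp Require Import boolp classical_sets.
Set Implicit Arguments.
Unset Strict Implicit.
Unset Printing Implicit Defensive.
Import GRing.Theory.
Local Open Scope classical_set_scope.
Local Open Scope ring_scope.

Definition is_ideal (R : comNzRingType) (I : set R) : Prop :=
  [/\ I 0, forall x y, I x -> I y -> I (x + y) & forall a x, I x -> I (a * x)].

Definition ideal_gen (R : comNzRingType) (X : set R) : set R :=
  smallest (@is_ideal R) X.

Definition radical (R : comNzRingType) (I : set R) : set R :=
  [set x | exists n, I (x ^+ n)].

Definition prime_ideal (R : comNzRingType) (P : set R) : Prop :=
  [/\ is_ideal P, ~ P 1 & forall x y, P (x * y) -> P x \/ P y].

Definition maximal_ideal (R : comNzRingType) (m : set R) : Prop :=
  [/\ is_ideal m, ~ m 1 &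
      forall J, is_ideal J -> ~ J 1 -> m `<=` J -> J = m].

Definition noetherian (R : comNzRingType) : Prop :=
  forall I : set R, is_ideal I -> exists s : seq R, I = ideal_gen [set` s].

Definition noetherian_local (R : comNzRingType) (m : set R) : Prop :=
  [/\ noetherian R, maximal_ideal m &
      forall n : set R, maximal_ideal n -> n = m].

Definition fin_gen (R : comNzRingType) (M : lmodType R) : Prop :=
  exists r (p : {linear 'rV[R]_r -> M}), forall u, exists v, p v = u.

Definition annihilator (R : comNzRingType) (M : lmodType R) : set R :=
  [set a | forall u : M, a *: u = 0].

Definition prime_chain (R : comNzRingType) (I : set R) (n : nat)
    (P : nat -> set R) : Prop :=
  (forall i, (i <= n)%N -> prime_ideal (P i) /\ I `<=` P i) /\
  (forall i, (i < n)%N -> P i `<` P i.+1).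

(* dim M = dim R/ann(M), and d is finite.  For M = R^o the annihilator is 0,
   so krull_dim R^o d says dim R = d. *)
Definition krull_dim (R : comNzRingType) (M : lmodType R) (d : nat) : Prop :=
  (exists P, prime_chain (annihilator M) d P) /\
  (forall n P, prime_chain (annihilator M) n P -> (n <= d)%N).

(* The submodule (s_0, ..., s_(n-1)) M. *)
Definition seq_mul (R : comNzRingType) (M : lmodType R) (s : seq R) : set M :=
  [set u | exists v : 'I_(size s) -> M, u = \sum_(i < size s) s`_i *: v i].

Definition regular_seq (R : comNzRingType) (M : lmodType R) (s : seq R) : Prop :=
  (forall i, (i < size s)%N -> forall u : M,
     seq_mul (take i s) (s`_i *: u) -> seq_mul (take i s) u) /\
  (exists u : M, ~ seq_mul s u).

Definition depth (R : comNzRingType) (m : set R) (M : lmodType R) (t : nat) :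
    Prop :=
  (exists s, [/\ regular_seq M s, [set` s] `<=` m & size s = t]) /\
  (forall s, regular_seq M s -> [set` s] `<=` m -> (size s <= t)%N).

(* Such modules are nonzero: the depth exists only if M <> 0. *)
Definition CM_module (R : comNzRingType) (m : set R) (M : lmodType R) : Prop :=
  fin_gen M /\ exists2 d, depth m M d & krull_dim M d.

Definition CM_local_ring (R : comNzRingType) (m : set R) : Prop :=
  noetherian_local m /\ CM_module m R^o.

Definition maximal_CM_module (R : comNzRingType) (m : set R) (M : lmodType R) :
    Prop :=
  CM_module m M /\ exists2 d, krull_dim M d & krull_dim R^o d.

Definition injective_module (R : comNzRingType) (E : lmodType R) : Prop :=
  forall (U V : lmodType R) (i : {linear U -> V}) (f : {linear U -> E}),
    injective i -> exists g : {linear V -> E}, forall u, g (i u) = f u.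

(* A resolution 0 -> M -> E 0 -> E 1 -> ... by injectives with E i = 0 for
   i > n. *)
Definition finite_inj_dim (R : comNzRingType) (M : lmodType R) : Prop :=
  exists (n : nat) (E : nat -> lmodType R) (e : {linear M -> E 0%N})
         (d : forall i, {linear E i -> E i.+1}),
  [/\ forall i, injective_module (E i),
      forall i, (n < i)%N -> forall x : E i, x = 0,
      injective e,
      forall x, d 0%N x = 0 <-> exists u, e u = x
    & forall i (x : E i.+1), d i.+1 x = 0 <-> exists y, d i y = x].

(* A resolution ... -> R^(b 1) -> R^(b 0) -> N -> 0; matrices act on row
   vectors from the right. *)
Definition free_resolution (R : comNzRingType) (N : lmodType R)
    (b : nat -> nat) (A : forall i, 'M[R]_(b i.+1, b i))
    (e : {linear 'rV[R]_(b 0%N) -> N}) : Prop :=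
  [/\ forall u, exists v, e v = u,
      forall v, e v = 0 <-> exists w, w *m A 0%N = v
    & forall i (v : 'rV[R]_(b i.+1)),
        v *m A i = 0 <-> exists w, w *m A i.+1 = v].

Section HomComplex.
Variables (R : comNzRingType) (M : lmodType R).
Variables (b : nat -> nat) (A : forall i, 'M[R]_(b i.+1, b i)).

Definition cocycle i (f : 'rV[R]_(b i) -> M) : Prop :=
  forall v, f (v *m A i) = 0.

Definition coboundary i : ('rV[R]_(b i) -> M) -> Prop :=
  match i with
  | 0 => fun h => forall v, h v = 0
  | j.+1 => fun h => exists g : {linear 'rV[R]_(b j) -> M},
                       forall v, h v = g (v *m A j)
  end.

End HomComplex.

(* k is the residue field R/m, as an R-module. *)
Definition residue_module (R : comNzRingType) (m : set R) (k : lmodType R) :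
    Prop :=
  exists p : {linear R^o -> k},
    (forall y, exists x, p x = y) /\ (forall x, p x = 0 <-> m x).

(* dim_k Ext^t(k, M) = r, with Ext^t(k, M) the cohomology of Hom(F, M) for a
   free resolution F of k: the classes of f_1, ..., f_r form a basis.
   As m annihilates Ext^t(k, M), scalars may be taken in R, and they vanish
   in k exactly when they lie in m. *)
Definition ext_residue_dim (R : comNzRingType) (m : set R) (M : lmodType R)
    (t r : nat) : Prop :=
  exists (k : lmodType R) (b : nat -> nat)
         (A : forall i, 'M[R]_(b i.+1, b i))
         (e : {linear 'rV[R]_(b 0%N) -> k})
         (f : 'I_r -> {linear 'rV[R]_(b t) -> M}),
  [/\ residue_module m k,
      free_resolution A e,
      forall j, cocycle A (f j),
      forall h : {linear 'rV[R]_(b t) -> M}, cocycle A h ->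
        exists c : 'I_r -> R,
          coboundary A (fun v => h v - \sum_j c j *: f j v)
    & forall c : 'I_r -> R,
        coboundary A (fun v => \sum_j c j *: f j v) -> forall j, m (c j)].

Definition CM_type (R : comNzRingType) (m : set R) (M : lmodType R) (r : nat) :
    Prop :=
  exists2 t, depth m M t & ext_residue_dim m M t r.

Definition canonical_module (R : comNzRingType) (m : set R) (M : lmodType R) :
    Prop :=
  [/\ maximal_CM_module m M, CM_type m M 1 & finite_inj_dim M].

(* For t = 0 the only minor is the empty determinant 1, so the ideal is R. *)
Definition minors_ideal (R : comNzRingType) (s r t : nat) (A : 'M[R]_(s, r)) :
    set R :=
  ideal_gen [set x | exists (f : 'I_t -> 'I_s) (g : 'I_t -> 'I_r),
    [/\ {homo f : i j / (i < j)%N}, {homo g : i j / (i < j)%N}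
      & x = \det (mxsub f g A)]].

Definition free_presentation (R : comNzRingType) (M : lmodType R) (s r : nat)
    (A : 'M[R]_(s, r)) (p : {linear 'rV[R]_r -> M}) : Prop :=
  (forall u, exists v, p v = u) /\
  (forall v, p v = 0 <-> exists w, w *m A = v).

(* The ideal I_(r-j)(A) of a chosen finite free presentation (set0 if there is
   none).  The subtraction is truncated, and I_t(A) = R for t <= 0. *)
Definition Fitt (R : comNzRingType) (j : nat) (M : lmodType R) : set R :=
  xget set0 [set I | exists s r (A : 'M[R]_(s, r)) (p : {linear 'rV[R]_r -> M}),
    free_presentation A p /\ I = minors_ideal (r - j) A].

Definition trace_ideal (R : comNzRingType) (M : lmodType R) : set R :=
  [set x | exists n (phi : 'I_n -> {linear M -> R^o}) (u : 'I_n -> M),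
    x = \sum_i phi i (u i)].

(* Main.v *)
From HB Require Import structures.
Require Import Defs.
From mathcomp Require Import all_boot all_order all_algebra perm.
From mathcomp Require Import boolp classical_sets.
Set Implicit Arguments.
Unset Strict Implicit.
Unset Printing Implicit Defensive.
Import GRing.Theory.
Local Open Scope classical_set_scope.
Local Open Scope ring_scope.

(** Both radicals describe the locus where [w] is locally free of rank one. The
    proof replaces localization by two elementary computations, which only need
    that [R -> End w] is bijective.

    If [delta] is a minor of size [r - 1] of a presentation matrix with [r]
    generators, then Cramer's rule puts [delta *: w] inside [R u] for some
    generator [u] ([minor_cyclic]). As [w] is faithful, [delta *: x = c *: u]
    determines [delta * c], so [x |-> delta * c] is a linear form, and it maps [u]
    to [delta ^+ 2] ([trace_of_cyclic]). Conversely, for a linear form [phi] and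
    an element [u], the endomorphism [x |-> phi x *: u] is multiplication by a
    scalar, which forces [phi u ^+ 2 *: w] into [R u] ([square_cyclic]); so a
    scalar matrix factors through a presentation matrix with one extra row, and
    its determinant, a power of [phi u], lies in the ideal of minors of size
    [r - 1] ([power_in_minors]).

    It remains to prove that [R -> End w] is bijective ([canonical_endo]). There
    are no quotient modules below: everything is done modulo a submodule.

    - [R] and [w] have a common regular sequence [s] of length [d = dim R]
      ([exists_common_regs]), since the existence of a regular sequence in [m] is
      equivalent to the vanishing of [Ext^i (k, -)] in low degrees, a condition
      that passes to [R * w]. The only prime containing [s] is [m]
      ([prime_over_regs]).
    - The socle of [w / s w] is [Ext^d (k, w)], which has dimension one
      ([Hdim1_regs]).
    - [w / s w] is faithful over [R / s] ([regs_quotient_faithful]). This is where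
      the finite injective dimension enters. In terms of an injective resolution,
      [Ext^i (R / J, w)] vanishes for [i <> d] and all [J] containing [s], and
      [Ext^d (R / s, w) = w / s w] ([ext_regs], [ext_vanish_low],
      [ext_vanish_high]). Hence [Ext^d] is exact on these modules and kills none
      of them, so no [a] outside [s] can act as zero on [w / s w].
    - Since [w / s w] has a simple socle, its submodules are determined by their
      annihilators, and every endomorphism is a scalar ([endo_simple_socle]).
    - Nakayama's lemma removes the elements of [s] one at a time ([descent]). *)

Section Submodules.
Variables (R : comNzRingType) (M : lmodType R).
Implicit Types (N P Q : set M) (u v z : M) (a y : R).

Definition submod N := N 0 /\ forall a u v, N u -> N v -> N (a *: u + v).

Definition add_span N z : set M := [set u | exists a n, N n /\ u = a *: z + n].
Definition add_mul N y : set M := [set u | exists v n, N n /\ u = y *: v + n].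
Definition colon N z : set R := [set a | N (a *: z)].

Lemma submod0 N : submod N -> N 0. Proof. by case. Qed.
Lemma submodZ N a u : submod N -> N u -> N (a *: u).
Proof. by move=> [N0 NL] Nu; rewrite -[_ *: _]addr0; apply: NL. Qed.
Lemma submodD N u v : submod N -> N u -> N v -> N (u + v).
Proof. by move=> [N0 NL] Nu Nv; rewrite -[u]scale1r; apply: NL. Qed.
Lemma submodN N u : submod N -> N u -> N (- u).
Proof. by move=> sN Nu; rewrite -scaleN1r; apply: submodZ. Qed.
Lemma submodB N u v : submod N -> N u -> N v -> N (u - v).
Proof. by move=> sN Nu Nv; apply: submodD => //; apply: submodN. Qed.
Lemma submod_sum N (I : Type) (r : seq I) (p : pred I) (F : I -> M) :
  submod N -> (forall i, p i -> N (F i)) -> N (\sum_(i <- r | p i) F i).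
Proof.
move=> sN NF; elim/big_ind : _ => //; first exact: submod0.
by move=> u v; apply: submodD.
Qed.
Lemma submodBr N u v : submod N -> N v -> N (u - v) -> N u.
Proof. by move=> sN Nv Nuv; rewrite -(subrK v u); apply: submodD. Qed.

Lemma submod_set0 : submod [set 0].
Proof. by split=> // a u v /= -> ->; rewrite scaler0 addr0. Qed.

Lemma submod_add_span N z : submod N -> submod (add_span N z).
Proof.
move=> sN; split; first by exists 0, 0; split; rewrite ?scale0r ?addr0 //; exact: submod0.
move=> c u v [a [n [Nn ->]]] [a' [n' [Nn' ->]]].
exists (c * a + a'), (c *: n + n'); split; first by case: sN => _; apply.
by rewrite scalerDr scalerDl scalerA addrACA.
Qed.

Lemma submod_add_mul N y : submod N -> submod (add_mul N y).
Proof.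
move=> sN; split; first by exists 0, 0; split; rewrite ?scaler0 ?addr0 //; exact: submod0.
move=> c u v [a [n [Nn ->]]] [a' [n' [Nn' ->]]].
exists (c *: a + a'), (c *: n + n'); split; first by case: sN => _; apply.
by rewrite !scalerDr !scalerA [c * y]mulrC addrACA.
Qed.

Lemma sub_add_span N z : N `<=` add_span N z.
Proof. by move=> n Nn; exists 0, n; rewrite scale0r add0r. Qed.
Lemma add_span_gen N z : submod N -> add_span N z z.
Proof. by move=> sN; exists 1, 0; rewrite scale1r addr0; split => //; apply: submod0. Qed.
Lemma add_span_sub N P z : submod P -> N `<=` P -> P z -> add_span N z `<=` P.
Proof.
move=> sP NP Pz _ [a [n [Nn ->]]]; apply: submodD => //; first exact: submodZ.
exact: NP.
Qed.
Lemma sub_add_mul N y : N `<=` add_mul N y.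
Proof. by move=> n Nn; exists 0, n; rewrite scaler0 add0r. Qed.

Lemma submod_bigcap N P : submod N -> submod P -> submod (N `&` P).
Proof.
move=> sN sP; split; first by split; apply: submod0.
by move=> a u v [Nu Pu] [Nv Pv]; split; [case: sN|case: sP] => _; apply.
Qed.

End Submodules.
#[global] Hint Resolve submod_set0 : core.

Lemma ideal_submod (R : comNzRingType) (I : set R) :
  is_ideal I <-> submod (I : set R^o).
Proof.
split=> [[I0 ID IM]|sI]; first by split=> // a u v Iu Iv; apply: ID => //; apply: IM.
split; first exact: (submod0 sI).
  by move=> x y; apply: (submodD sI).
by move=> a x Ix; apply: (submodZ a sI Ix).
Qed.

Lemma submod_colon (R : comNzRingType) (M : lmodType R) (N : set M) (z : M) :
  submod N -> submod (colon N z : set R^o).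
Proof.
move=> sN; split; first by rewrite /colon /= scale0r; apply: submod0.
move=> a x y; rewrite /colon /= => Nx Ny; rewrite scalerDl -scalerA.
by case: sN => _; apply.
Qed.

(** * Noetherian modules *)
(** The maximal condition for families of submodules. It is used both to choose
    maximal submodules directly and for induction. *)
Definition noeth (R : comNzRingType) (M : lmodType R) :=
  forall F : set (set M), (exists N, F N) -> (forall N, F N -> submod N) ->
  exists N, F N /\ forall N', F N' -> N `<=` N' -> N' `<=` N.

Lemma noeth_ring (R : comNzRingType) : noetherian R -> noeth R^o.
Proof.
move=> noR F [N0 FN0] sF.
pose T := {N : set R | F N}.
pose le (a b : T) := `[< sval a `<=` sval b >].
have [|||A Atot|t tmax] := @Zorn T le.
- by move=> a; apply/asboolP.
- by move=> a b c /asboolP ab /asboolP bc; apply/asboolP => x /ab /bc.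
- move=> [a Fa] [b Fb] /asboolP ab /asboolP ba; apply: eq_exist.
  by apply/seteqP.
- have [[t0 At0]|noA] := pselect (exists t, A t); last first.
    by exists (exist _ N0 FN0) => s As; case: noA; exists s.
  pose U : set R := [set x | exists2 t, A t & sval t x].
  have idU : is_ideal U.
    apply/ideal_submod; split; first by exists t0 => //; apply: (submod0 (sF _ (svalP t0))).
    move=> a x y [t At tx] [s As sy].
    have [/asboolP ts|/asboolP st] := Atot _ _ At As.
      by exists s => //; apply: (proj2 (sF _ (svalP s))) => //; apply: ts.
    by exists t => //; apply: (proj2 (sF _ (svalP t))) => //; apply: st.
  have [s Us] := noR _ idU.
  have : exists2 t, A t & [set` s] `<=` sval t.
    have : [set` s] `<=` U by rewrite Us; apply: sub_gen_smallest.
    elim: s {Us} => [|x s IH] sU; first by exists t0.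
    have [|t At st] := IH; first by move=> z zs; apply: sU; rewrite /= inE zs orbT.
    have [|r Ar rx] := sU x; first by rewrite /= inE eqxx.
    have [/asboolP tr|/asboolP rt] := Atot _ _ At Ar.
      exists r => // z; rewrite /= inE => /orP[/eqP->//|zs]; exact/tr/st.
    exists t => // z; rewrite /= inE => /orP[/eqP->//|zs]; [exact/rt|exact/st].
  case=> t At st; exists t => r Ar; apply/asboolP.
  apply: (@subset_trans _ U); first by move=> x rx; exists r.
  rewrite Us; apply: smallest_sub => //.
  by apply/ideal_submod; apply: sF (svalP t).
exists (sval t); split; first exact: svalP.
move=> N' FN' tN'; by have := tmax (exist _ N' FN') (asboolT tN') => <-.
Qed.

Lemma noeth_image (R : comNzRingType) (M M' : lmodType R) (p : {linear M -> M'}) :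
  (forall u, exists v, p v = u) -> noeth M -> noeth M'.
Proof.
move=> psurj nM F [N0 FN0] sF.
have [||_ [[N FN <-] Nmax]] := nM [set p @^-1` N | N in F].
- by exists (p @^-1` N0), N0.
- move=> _ [N FN <-]; split; first by rewrite /preimage /= linear0; apply: submod0; apply: sF.
  by move=> a u v; rewrite /preimage /= linearP; case: (sF _ FN) => _; apply.
exists N; split => // N' FN' NN' u; have [v <-] := psurj u.
apply: (Nmax (p @^-1` N')); first by exists N'.
by move=> x /=; apply: NN'.
Qed.

(** Two successive maximal choices: first of the part of [N] killed by [f], then
    of the image of [N] under [f]; together they determine [N]. *)
Lemma noeth_embed (R : comNzRingType) (M A B : lmodType R)
    (f : {linear M -> A}) (g : {linear M -> B}) :
  (forall u, f u = 0 -> g u = 0 -> u = 0) -> noeth A -> noeth B -> noeth M.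
Proof.
move=> fg0 nA nB F [N0 FN0] sF.
pose K (N : set M) : set B := [set g u | u in [set u | N u /\ f u = 0]].
pose I (N : set M) : set A := [set f u | u in N].
have sK N : submod N -> submod (K N).
  move=> sN; split.
    by exists 0; rewrite ?linear0 //; split; rewrite ?linear0 //; apply: submod0.
  move=> a _ _ [u [Nu fu] <-] [v [Nv fv] <-].
  exists (a *: u + v); rewrite ?linearP //; split; first by case: sN => _; apply.
  by rewrite linearP fu fv scaler0 addr0.
have sI N : submod N -> submod (I N).
  move=> sN; split; first by exists 0; rewrite ?linear0 //; apply: submod0.
  move=> a _ _ [u Nu <-] [v Nv <-]; exists (a *: u + v); rewrite ?linearP //.
  by case: sN => _; apply.
have [||_ [[N1 FN1 <-] Kmax]] := nB [set K N | N in F].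
- by exists (K N0), N0.
- by move=> _ [N FN <-]; apply: sK; apply: sF.
have [||_ [[N [FN KN] <-] Imax]] := nA [set I N | N in [set N | F N /\ K N1 `<=` K N]].
- by exists (I N1), N1 => //; split.
- by move=> _ [N [FN _] <-]; apply: sI; apply: sF.
exists N; split => // N' FN' NN' u N'u.
have KN' : K N `<=` K N' by move=> _ [v [Nv fv] <-]; exists v => //; split => //; apply: NN'.
have KN'1 : K N' `<=` K N1 by apply: Kmax; [exists N'|by move=> x /KN /KN'].
have IN' : I N' `<=` I N.
  apply: Imax; first by exists N' => //; split => // x /KN /KN'.
  by move=> _ [v Nv <-]; exists v => //; apply: NN'.
have [|v Nv fvu] := IN' (f u); first by exists u.
have sN' := sF _ FN'; have N'uv : N' (u - v) by apply: submodB => //; apply: NN'.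
have [x [Nx fx] gx] : K N (g (u - v)).
  by apply: KN; apply: KN'1; exists (u - v) => //; split; rewrite // linearB fvu subrr.
have : u - v - x = 0.
  by apply: fg0; rewrite linearB ?gx ?subrr // fx linearB fvu subrr subr0.
move=> /eqP; rewrite subr_eq0 subr_eq => /eqP ->.
by apply: submodD => //; apply: sF.
Qed.

Lemma noeth_pair (R : comNzRingType) (A B : lmodType R) :
  noeth A -> noeth B -> noeth (A * B)%type.
Proof.
move=> nA nB; have := @noeth_embed R (A * B)%type A B fst snd.
by apply=> // -[a b] /= -> ->.
Qed.

Section NoethFfun.
Variables (R : comNzRingType) (A : lmodType R) (n : nat).
Let M := {ffun 'I_n.+1 -> A}.
Let hd (f : M) : A := f ord0.
Let tl (f : M) : {ffun 'I_n -> A} := [ffun i => f (lift ord0 i)].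
Fact hd_linear : linear hd.
Proof. by move=> a f g; rewrite /hd !ffunE. Qed.
Fact tl_linear : linear tl.
Proof. by move=> a f g; apply/ffunP => i; rewrite !ffunE. Qed.
HB.instance Definition _ := GRing.isLinear.Build R M A *:%R hd hd_linear.
HB.instance Definition _ := GRing.isLinear.Build R M {ffun 'I_n -> A} *:%R tl tl_linear.

Lemma noeth_ffunS : noeth A -> noeth {ffun 'I_n -> A} -> noeth {ffun 'I_n.+1 -> A}.
Proof.
apply: (@noeth_embed R M A {ffun 'I_n -> A} hd tl) => f f0 f1; apply/ffunP => i.
rewrite ffunE; have [j ->|->//] := unliftP ord0 i.
by move/ffunP/(_ j): f1; rewrite !ffunE.
Qed.
End NoethFfun.

Lemma noeth_ffun (R : comNzRingType) (A : lmodType R) n :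
  noeth A -> noeth {ffun 'I_n -> A}.
Proof.
move=> nA; elim: n => [|n IH]; last exact: noeth_ffunS.
move=> F [N FN] sF; exists N; split=> // N' FN' _ u _.
suff -> : u = 0 by apply: submod0; apply: sF.
by apply/ffunP; case.
Qed.

Section RowFfun.
Variables (R : comNzRingType) (n : nat).
Let row_of (f : {ffun 'I_n -> R^o}) : 'rV[R]_n := \row_i f i.
Fact row_of_linear : linear row_of.
Proof. by move=> a f g; apply/rowP => i; rewrite !mxE !ffunE. Qed.
HB.instance Definition _ :=
  GRing.isLinear.Build R {ffun 'I_n -> R^o} 'rV[R]_n *:%R row_of row_of_linear.

Lemma noeth_row : noetherian R -> noeth 'rV[R]_n.
Proof.
move=> noR; have nA : noeth {ffun 'I_n -> R^o} by apply: noeth_ffun; apply: noeth_ring.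
apply: (@noeth_image R {ffun 'I_n -> R^o} 'rV[R]_n row_of _ nA) => v.
by exists [ffun i => v 0 i]; apply/rowP => i; rewrite mxE ffunE.
Qed.
End RowFfun.

Lemma noeth_fin_gen (R : comNzRingType) (M : lmodType R) :
  noetherian R -> fin_gen M -> noeth M.
Proof. by move=> noR [r [p psurj]]; exact: (noeth_image psurj (noeth_row (n := r) noR)). Qed.

Lemma noeth_ind (R : comNzRingType) (P : set R -> Prop) : noeth R^o ->
  (forall I, submod (I : set R^o) ->
     (forall J, submod (J : set R^o) -> I `<=` J -> ~ (J `<=` I) -> P J) -> P I) ->
  forall I, submod (I : set R^o) -> P I.
Proof.
move=> nR step I sI; apply: contrapT => nP.
have [||J [[sJ nPJ] Jmax]] := nR [set J | submod (J : set R^o) /\ ~ P J].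
- by exists I.
- by move=> N [].
apply: nPJ; apply: step => // K sK JK nKJ; apply: contrapT => nPK.
by apply: nKJ; apply: Jmax.
Qed.

(** * Maximal annihilators and local rings *)

(** A proper annihilator that is maximal among annihilators of elements
    outside [N] is prime: if [b *: z] is still outside [N], then its annihilator
    is no larger than that of [z]. *)
Lemma maximal_colon (R : comNzRingType) (M : lmodType R) (N : set M) (u : M) :
  noeth R^o -> submod N -> ~ N u ->
  exists z, [/\ ~ N z, colon N u `<=` colon N z, prime_ideal (colon N z)
    & forall z', ~ N z' -> colon N z `<=` colon N z' -> colon N z' `<=` colon N z].
Proof.
move=> nR sN Nu.
have [||_ [[z [Nz uz] <-] zmax]] :=
  nR [set colon N z | z in [set z | ~ N z /\ colon N u `<=` colon N z]].
- by exists (colon N u), u => //; split.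
- by move=> _ [z _ <-]; apply: submod_colon.
have zm z' : ~ N z' -> colon N z `<=` colon N z' -> colon N z' `<=` colon N z.
  by move=> Nz' zz'; apply: zmax => //; exists z' => //; split=> // a /uz/zz'.
exists z; split => //; split; first by apply/ideal_submod; apply: submod_colon.
  by rewrite /colon /= scale1r.
move=> a b; rewrite {1}/colon /= -scalerA => Nabz.
have [Nbz|Nbz] := pselect (N (b *: z)); [by right|left].
apply: (zm (b *: z)) => // c cz; rewrite /colon /= scalerA mulrC -scalerA.
by apply: submodZ.
Qed.

Section Local.
Variables (R : comNzRingType) (m : set R).
Hypothesis lm : noetherian_local m.

Lemma local_noeth : noeth R^o.
Proof. by case: lm => /noeth_ring. Qed.

Lemma local_submod : submod (m : set R^o).
Proof. by case: lm => _ [/ideal_submod]. Qed.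

Lemma local1 : ~ m 1.
Proof. by case: lm => _ []. Qed.

Lemma proper_sub_local (I : set R) : submod (I : set R^o) -> ~ I 1 -> I `<=` m.
Proof.
move=> sI I1.
have [||J [[sJ J1 IJ] Jmax]] := local_noeth
  (F := [set J | [/\ submod (J : set R^o), ~ J 1 & I `<=` J]]).
- by exists I; split.
- by move=> J [].
case: lm => _ _ /(_ J) <- //; split => //; first exact/ideal_submod.
move=> K idK K1 JK; apply/seteqP; split => //; apply: Jmax => //; split => //.
  exact/ideal_submod.
by move=> x /IJ/JK.
Qed.

Lemma local_unit (a : R) : ~ m a -> exists b, b * a = 1.
Proof.
move=> ma; apply: contrapT => nu; apply: ma.
apply: (@proper_sub_local [set x | exists b, b * a = x]); last by exists 1; rewrite mul1r.
  split; first by exists 0; rewrite mul0r.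
  move=> c x y [b <-] [b' <-]; exists (c * b + b').
  by rewrite mulrDl -mulrA.
by move=> [b ba]; apply: nu; exists b.
Qed.

Lemma local_unit1B (y : R) : m y -> exists b, b * (1 - y) = 1.
Proof.
move=> my; apply: local_unit => m1y; apply: local1.
by rewrite -(subrK y 1); apply: (submodD local_submod).
Qed.

(** Nakayama's lemma without quotients: if [N] is not contained in [P], then a
    maximal proper submodule [Q] of [N] containing [N `&` P] exists, and since
    [N / Q] is simple it is killed by [m]. *)
Lemma nakayama (M : lmodType R) (N P : set M) :
  noeth M -> submod N -> submod P -> ~ (N `<=` P) ->
  exists Q : set M, [/\ submod Q, N `&` P `<=` Q, Q `<=` N, ~ (N `<=` Q)
    & forall y n, m y -> N n -> Q (y *: n)].
Proof.
move=> nM sN sP NP.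
have [||Q [[sQ NPQ QN NQ] Qmax]] := nM
  [set Q | [/\ submod Q, N `&` P `<=` Q, Q `<=` N & ~ (N `<=` Q)]].
- exists (N `&` P); split; [exact: submod_bigcap|by []|by move=> x []|].
  by move=> h; apply: NP => x Nx; case: (h x Nx).
- by move=> Q [].
exists Q; split => // y n my Nn; apply: contrapT => Qyn.
have NQyn : N `<=` add_span Q (y *: n).
  apply: contrapT => nN; apply: Qyn.
  apply: (Qmax (add_span Q (y *: n))); last 2 first.
  - exact: sub_add_span.
  - exact: add_span_gen.
  split => //; first exact: submod_add_span.
    by move=> x /NPQ; apply: sub_add_span.
  by apply: add_span_sub => //; apply: submodZ.
have [r [q [Qq e]]] := NQyn n Nn.
have [|b b1] := @local_unit1B (r * y).
  by apply: (submodZ r local_submod my).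
apply: Qyn; apply: submodZ => //.
rewrite -[n]scale1r -b1 -scalerA; apply: submodZ => //.
by rewrite scalerBl scale1r {1}e scalerA addrAC subrr add0r.
Qed.

End Local.

(** A maximal submodule among the row spaces contained in [N] is all of [N]. *)
Lemma noeth_row_span (R : comNzRingType) r (N : set 'rV[R]_r) :
  noetherian R -> submod N ->
  exists s (A : 'M[R]_(s, r)), forall v, N v <-> exists w, w *m A = v.
Proof.
move=> noR sN.
have sS s (A : 'M[R]_(s, r)) : submod [set v | exists w, w *m A = v].
  split; first by exists 0; rewrite mul0mx.
  move=> a _ _ [w <-] [w' <-]; exists (a *: w + w').
  by rewrite mulmxDl -scalemxAl.
have [||_ [[s [A [AN <-]]] Amax]] := noeth_row noR (F :=
  [set S | exists s (A : 'M[R]_(s, r)), (forall w, N (w *m A)) /\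
     [set v | exists w, w *m A = v] = S]).
- exists [set v | exists w, w *m (0 : 'M[R]_(0, r)) = v], 0%N, 0; split=> // w.
  by rewrite mulmx0; apply: submod0.
- by move=> _ [s [A [_ <-]]]; apply: sS.
exists s, A => v; split; last by move=> [w <-].
move=> Nv; apply: (Amax [set x | exists w, w *m col_mx A v = x]).
- exists _, (col_mx A v); split => // w; rewrite -[w]hsubmxK mul_row_col.
  apply: submodD => //; rewrite [rsubmx w]mx11_scalar mul_scalar_mx.
  exact: submodZ.
- by move=> _ [w <-]; exists (row_mx w 0); rewrite mul_row_col mul0mx addr0.
- by exists (row_mx 0 1); rewrite mul_row_col mul0mx add0r mul1mx.
Qed.

Lemma finite_presentation (R : comNzRingType) (M : lmodType R) :
  noetherian R -> fin_gen M ->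
  exists s r (A : 'M[R]_(s, r)) (p : {linear 'rV[R]_r -> M}), free_presentation A p.
Proof.
move=> noR [r [p psurj]].
have [|s [A kerA]] := @noeth_row_span R r [set v | p v = 0] noR; last by exists s, r, A, p.
split => [|a u v /= pu pv]; first by rewrite /= linear0.
by rewrite linearP pu pv scaler0 addr0.
Qed.

(** * Regular sequences and cohomology of the residue field *)

(** Sequences are listed with the last element first, so that adding an element
    to a sequence is [cons]. *)
Fixpoint seqM (R : comNzRingType) (M : lmodType R) (s : seq R) : set M :=
  if s is y :: s' then add_mul (seqM s') y else [set 0].

Definition nonzerodiv_mod (R : comNzRingType) (M : lmodType R) (N : set M) (y : R) :=
  forall u, N (y *: u) -> N u.

Fixpoint regs (R : comNzRingType) (M : lmodType R) (s : seq R) : Prop :=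
  if s is y :: s' then regs M s' /\ nonzerodiv_mod (@seqM R M s') y else True.

Arguments seqM {R} M s.

Lemma submod_seqM (R : comNzRingType) (M : lmodType R) s : submod (seqM M s).
Proof. by elim: s => [|y s IH] //=; apply: submod_add_mul. Qed.
#[global] Hint Resolve submod_seqM : core.

Lemma seq_mul_rcons (R : comNzRingType) (M : lmodType R) (s : seq R) y :
  @seq_mul R M (rcons s y) = add_mul (seq_mul s) y.
Proof.
apply/seteqP; split=> u.
  move=> [v ->]; have e : size (rcons s y) = (size s).+1 by rewrite size_rcons.
  pose v' (i : nat) := if insub i is Some j then v j else 0.
  have vE i : v i = v' i by rewrite /v' valK.
  exists (v' (size s)), (\sum_(i < size s) s`_i *: v' i); split; first by exists (fun i => v' i).
  under eq_bigr do rewrite vE.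
  rewrite -(big_mkord xpredT (fun i => (rcons s y)`_i *: v' i)) e big_nat_recr //=.
  rewrite nth_rcons ltnn eqxx addrC big_mkord; congr (_ + _).
  by apply: eq_bigr => i _; rewrite nth_rcons ltn_ord.
move=> [w [_ [[v ->] ->]]].
pose v' (i : nat) := if insub i is Some j then v j else w.
exists (fun i => v' i).
rewrite -(big_mkord xpredT (fun i => (rcons s y)`_i *: v' i)) size_rcons big_nat_recr //=.
rewrite nth_rcons ltnn eqxx addrC big_mkord; congr (_ + _).
  by rewrite /v' insubF // ltnn.
by apply: eq_bigr => i _; rewrite nth_rcons ltn_ord /v' valK.
Qed.

Lemma seq_mul_seqM (R : comNzRingType) (M : lmodType R) (s : seq R) :
  @seq_mul R M s = seqM M (rev s).
Proof.
elim/last_ind: s => [|s y IH]; last by rewrite rev_rcons /= seq_mul_rcons IH.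
apply/seteqP; split=> u /=; first by move=> [v ->]; rewrite big_ord0.
by move=> ->; exists (fun=> 0); rewrite big_ord0.
Qed.

Lemma regular_seq_regs (R : comNzRingType) (M : lmodType R) (s : seq R) :
  regular_seq M s -> regs M (rev s).
Proof.
move=> [+ _]; elim/last_ind: s => [|s y IH] // reg.
rewrite rev_rcons /=; split.
  apply: IH => i si u; have := reg i; rewrite size_rcons ltnS (ltnW si) => /(_ isT u).
  by rewrite -cats1 take_cat nth_cat si.
have := reg (size s); rewrite size_rcons ltnSn => /(_ isT) h u.
by have := h u; rewrite -cats1 take_size_cat // nth_cat ltnn subnn /= seq_mul_seqM.
Qed.

(** If [f] lists the values of a linear map on the standard basis of row vectors,
    then [act B f] lists those of its composite with [fun v => v *m B]. *)
Definition act (R : comNzRingType) (M : lmodType R) p q (B : 'M[R]_(p, q))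
  (f : 'I_q -> M) : 'I_p -> M := fun i => \sum_j B i j *: f j.

Section Act.
Variables (R : comNzRingType) (M : lmodType R) (p q : nat).
Implicit Types (B : 'M[R]_(p, q)) (f g : 'I_q -> M) (N : set M).

Lemma act_linear B a f g i :
  act B (fun j => a *: f j + g j) i = a *: act B f i + act B g i.
Proof.
rewrite /act scaler_sumr -big_split /=; apply: eq_bigr => j _.
by rewrite scalerDr !scalerA mulrC.
Qed.

Lemma act_mul r B (C : 'M[R]_(r, p)) f i : act (C *m B) f i = act C (act B f) i.
Proof.
rewrite /act; under eq_bigr do rewrite mxE scaler_suml.
rewrite exchange_big; apply: eq_bigr => j _ /=.
by rewrite scaler_sumr; apply: eq_bigr => l _; rewrite scalerA.
Qed.

Lemma actD B B' f i : act (B + B') f i = act B f i + act B' f i.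
Proof.
by rewrite /act -big_split; apply: eq_bigr => j _; rewrite mxE scalerDl.
Qed.

Lemma act_in N B f i : submod N -> (forall j, N (f j)) -> N (act B f i).
Proof. by move=> sN Nf; apply: submod_sum => // j _; apply: submodZ. Qed.

Lemma act_congr N B f g i :
  submod N -> (forall j, N (f j - g j)) -> N (act B f i - act B g i).
Proof.
move=> sN h; rewrite /act -sumrB; apply: submod_sum => // j _.
by rewrite -scalerBr; apply: submodZ.
Qed.

Lemma act0 f i : act (0 : 'M_(p, q)) f i = 0.
Proof. by rewrite /act big1 // => j _; rewrite mxE scale0r. Qed.
End Act.

Lemma act_scalar (R : comNzRingType) (M : lmodType R) n (a : R) (f : 'I_n -> M) i :
  act a%:M f i = a *: f i.
Proof.
rewrite /act (bigD1 i) //= big1 ?addr0 ?mxE ?eqxx // => j ji.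
by rewrite mxE eq_sym (negbTE ji) scale0r.
Qed.

Lemma row_lift (R : comNzRingType) p q r (B : 'M[R]_(p, r)) (C : 'M[R]_(q, r)) :
  (forall i, exists w, w *m C = row i B) -> exists S, S *m C = B.
Proof.
move=> h; have [w wC] := choice h; exists (\matrix_i w i).
by apply/row_matrixP => i; rewrite row_mul rowK.
Qed.

Section ResidueCohomology.
Variables (R : comNzRingType) (m : set R) (k : lmodType R) (b : nat -> nat).
Variables (A : forall i, 'M[R]_(b i.+1, b i)) (e : {linear 'rV[R]_(b 0%N) -> k}).
Hypotheses (lm : noetherian_local m) (km : residue_module m k).
Hypothesis (resA : free_resolution A e).

Lemma res_complex i : A i.+1 *m A i = 0.
Proof.
case: resA => _ _ ex; apply/row_matrixP => j; rewrite row_mul row0.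
by apply/ex; exists (delta_mx 0 j); rewrite -rowE.
Qed.

Lemma residue_kill y (x : k) : m y -> y *: x = 0.
Proof.
move=> my; case: km => p [psurj pm]; have [z <-] := psurj x.
rewrite -linearZ; apply/pm; rewrite /= /GRing.scale /= mulrC.
exact: (submodZ z (local_submod lm) my).
Qed.

(** Multiplication by an element of the maximal ideal is zero on the residue
    field, hence null-homotopic on its resolution. *)
Lemma homotopy0 y : m y -> exists S, S *m A 0%N = y%:M.
Proof.
move=> my; apply: row_lift => i; case: resA => _ ex _; apply/ex.
by rewrite -scalemx1 [row _ _]linearZ linearZ; apply: residue_kill.
Qed.

Lemma homotopyS y i : m y -> exists S T, S *m A i.+1 + A i *m T = y%:M.
Proof.
move=> my; case: (resA) => _ _ ex.
have lift j (B : 'M_(b j.+1)) : B *m A j = 0 -> exists S, S *m A j.+1 = B.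
  by move=> B0; apply: row_lift => l; apply/ex; rewrite -row_mul B0 row0.
elim: i => [|i [S [T ST]]].
  have [T TA] := homotopy0 my; have [|S SA] := lift 0%N (y%:M - A 0%N *m T).
    by rewrite mulmxBl -mulmxA TA mul_scalar_mx mul_mx_scalar subrr.
  by exists S, T; rewrite SA subrK.
have [|S' SA] := lift i.+1 (y%:M - A i.+1 *m S).
  rewrite mulmxBl mul_scalar_mx -mul_mx_scalar -ST mulmxDr !mulmxA res_complex.
  by rewrite mul0mx addr0 subrr.
by exists S', S; rewrite SA subrK.
Qed.

Section Coefficients.
Variable M : lmodType R.
Implicit Types (N : set M) (y : R).

(** These describe the complex of linear maps from the resolution to [M / N],
    whose cohomology is [Ext (k, M / N)]; a linear map is recorded by the images
    of the standard basis, lifted to [M]. *)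
Definition cocycle_mod N i (f : 'I_(b i) -> M) := forall l, N (act (A i) f l).

Definition coboundary_mod N i : ('I_(b i) -> M) -> Prop :=
  match i with
  | 0 => fun f => forall l, N (f l)
  | j.+1 => fun f => exists g, forall l, N (f l - act (A j) g l)
  end.

Arguments cocycle_mod : clear implicits.
Arguments coboundary_mod : clear implicits.

Definition Hvanish N i := forall f, cocycle_mod N i f -> coboundary_mod N i f.

(** Over the residue field, no two classes are linearly independent. *)
Definition Hdim1 N i := forall f g, cocycle_mod N i f -> cocycle_mod N i g ->
  exists a c, ~ (m a /\ m c) /\ coboundary_mod N i (fun l => a *: f l + c *: g l).

Lemma act_complex i (f : 'I_(b i) -> M) l : act (A i.+1) (act (A i) f) l = 0.
Proof. by rewrite -act_mul res_complex act0. Qed.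

Lemma coboundary_mod0 N i : submod N -> coboundary_mod N i (fun=> 0).
Proof.
move=> sN; case: i => [|i] /=; first by move=> _; apply: submod0.
by exists (fun=> 0) => l; rewrite /act big1 ?subrr => [|j _]; [apply: submod0|rewrite scaler0].
Qed.

Lemma coboundary_mod_lin N i a f g : submod N -> coboundary_mod N i f ->
  coboundary_mod N i g -> coboundary_mod N i (fun l => a *: f l + g l).
Proof.
move=> sN; case: i f g => [|i] f g /=.
  by move=> Nf Ng l; case: sN => _; apply.
move=> [f' hf] [g' hg]; exists (fun j => a *: f' j + g' j) => l.
by rewrite act_linear opprD addrACA -scalerBr; case: sN => _; apply.
Qed.

Lemma coboundary_mod_kill N y i f : submod N -> m y -> cocycle_mod N i f ->
  coboundary_mod N i (fun l => y *: f l).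
Proof.
move=> sN my; case: i f => [|i] f cf /=.
  move=> l; have [S SA] := homotopy0 my.
  by rewrite -act_scalar -SA act_mul; apply: act_in.
have [S [T ST]] := homotopyS i my; exists (act T f) => l.
by rewrite -act_scalar -ST actD !act_mul addrK; apply: act_in.
Qed.

Lemma Hvanish0 N y : submod N -> m y -> nonzerodiv_mod N y -> Hvanish N 0.
Proof.
move=> sN my yN f cf l; apply: yN; have [S SA] := homotopy0 my.
by rewrite -act_scalar -SA act_mul; apply: act_in.
Qed.

(** If [f] is a cocycle, then [y *: f] is a coboundary [act (A i) h] by the
    homotopy. So [h] is a cocycle modulo [N + y M], and subtracting a coboundary
    makes it divisible by [y], which then cancels. *)
Lemma Hvanish_up N y i : submod N -> m y -> nonzerodiv_mod N y ->
  Hvanish (add_mul N y) i -> Hvanish N i.+1.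
Proof.
move=> sN my yN van f cf; have [S [T ST]] := homotopyS i my.
have yf l : N (y *: f l - act (A i) (act T f) l).
  by rewrite -act_scalar -ST actD !act_mul addrK; apply: act_in.
suff [g yfg] : exists g, forall l, N (y *: (f l - act (A i) g l)).
  by exists g => l; apply: yN.
have /van : cocycle_mod (add_mul N y) i (act T f).
  move=> l; exists (f l), (act (A i) (act T f) l - y *: f l).
  by split; [rewrite -opprB; apply: submodN|rewrite addrCA subrr addr0].
case: i S T {ST van} f cf yf => [|i] S T f cf yf /=.
  move=> /choice[g /choice[n h]]; exists g => l.
  rewrite scalerBr; apply: (submodBr (v := act (A 0%N) (act T f) l - y *: act (A 0%N) g l)) => //.
    have -> : y *: act (A 0%N) g l = act (A 0%N) (fun j => y *: g j) l.
      by rewrite /act scaler_sumr; apply: eq_bigr => j _; rewrite !scalerA mulrC.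
    apply: act_congr => // j; have [Nn ->] := h j.
    by rewrite addrAC subrr add0r.
  by rewrite opprB addrA subrK; apply: yf.
move=> [g0 /choice[g /choice[n h]]]; exists g => l.
rewrite scalerBr; apply: (submodBr (v := act (A i.+1) (act T f) l - y *: act (A i.+1) g l)) => //.
  have -> : y *: act (A i.+1) g l = act (A i.+1) (fun j => y *: g j + act (A i) g0 j) l.
    by rewrite act_linear act_complex addr0.
  apply: act_congr => // j; have [Nn e'] := h j.
  by rewrite opprD addrA addrAC e' addrAC subrr add0r.
by rewrite opprB addrA subrK; apply: yf.
Qed.

Lemma connecting_cocycle N y i f g n : submod N -> nonzerodiv_mod N y ->
  (forall l, N (n l) /\ act (A i) f l = y *: g l + n l) -> cocycle_mod N i.+1 g.
Proof.
move=> sN yN h l; apply: yN.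
have -> : y *: act (A i.+1) g l = - act (A i.+1) n l.
  apply/eqP; rewrite -subr_eq0 opprK -act_linear.
  rewrite (_ : (fun j => _) = act (A i) f); last by apply: funext => j; case: (h j).
  by rewrite act_complex.
by apply: submodN => //; apply: act_in => // j; case: (h j).
Qed.

(** The [g] of this relation represents the image of the class of [f] under the
    connecting map of [0 -> M / N -> M / N -> M / (N + y M) -> 0]; that map is
    injective because its kernel comes from the degree [i] cohomology modulo [N]. *)
Lemma connecting_injective N y i f g n : submod N -> Hvanish N i ->
  (forall l, N (n l) /\ act (A i) f l = y *: g l + n l) ->
  coboundary_mod N i.+1 g -> coboundary_mod (add_mul N y) i f.
Proof.
move=> sN van h [g' hg'].
have /van : cocycle_mod N i (fun j => - y *: g' j + f j).
  move=> l; rewrite act_linear; have [Nn ->] := h l.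
  rewrite addrA scaleNr [- _ + _]addrC -scalerBr.
  by apply: submodD => //; apply: submodZ.
case: i f g n h van g' hg' => [|i] f g n h van g' hg' /=.
  move=> H l; exists (g' l), (- y *: g' l + f l); split; first exact: H.
  by rewrite scaleNr addrA subrr add0r.
move=> [g0 H]; exists g0 => l; exists (g' l), (- y *: g' l + f l - act (A i) g0 l).
by split; [exact: H|rewrite scaleNr !addrA subrr add0r].
Qed.

Lemma Hvanish_down N y i : submod N -> nonzerodiv_mod N y ->
  Hvanish N i -> Hvanish N i.+1 -> Hvanish (add_mul N y) i.
Proof.
move=> sN yN van vanS f /choice[g /choice[n h]].
apply: (connecting_injective sN van h); apply: vanS.
exact: (connecting_cocycle sN yN h).
Qed.

Lemma Hdim1_down N y i : submod N -> nonzerodiv_mod N y ->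
  Hvanish N i -> Hdim1 N i.+1 -> Hdim1 (add_mul N y) i.
Proof.
move=> sN yN van dimS f1 f2 /choice[g1 /choice[n1 h1]] /choice[g2 /choice[n2 h2]].
have [a [c [ac bd]]] := dimS _ _ (connecting_cocycle sN yN h1) (connecting_cocycle sN yN h2).
exists a, c; split => //.
apply: (connecting_injective (n := fun l => a *: n1 l + c *: n2 l) sN van _ bd) => l.
have [Nn1 e1] := h1 l; have [Nn2 e2] := h2 l.
split; first by apply: submodD => //; apply: submodZ.
rewrite act_linear (_ : act (A i) (fun j => c *: f2 j) l = c *: act (A i) f2 l); last first.
  by rewrite /act scaler_sumr; apply: eq_bigr => j _; rewrite !scalerA mulrC.
by rewrite e1 e2 !scalerDr !scalerA [a * y]mulrC [c * y]mulrC addrACA.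
Qed.

(** Induction on [s1] from its far end, the elements of which are divided out
    first: each of them trades one degree for one step of the sequence. *)
Lemma Hvanish_regs s1 s2 i : regs M (s1 ++ s2) -> [set` s1] `<=` m ->
  (i < size s1)%N -> Hvanish (seqM M s2) i.
Proof.
elim/last_ind: s1 s2 i => [//|s1 y IH] s2 i rs sm; rewrite size_rcons.
have my : m y by apply: sm; rewrite /= mem_rcons mem_head.
have sm1 : [set` s1] `<=` m by move=> z zs; apply: sm; rewrite /= mem_rcons inE zs orbT.
move: rs; rewrite cat_rcons => rs.
have [_ yN] : regs M (y :: s2) by elim: (s1) rs => //= z t IHt [/IHt].
case: i => [_|i is1]; first exact: Hvanish0 my yN.
by apply: Hvanish_up my yN _ => //; apply: (IH (y :: s2)).
Qed.

(** The top cohomology and the socle of [M / s M] are identified by [size s]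
    connecting maps. *)
Lemma Hdim1_regs s : regs M s -> [set` s] `<=` m ->
  Hdim1 [set 0] (size s) -> Hdim1 (seqM M s) 0.
Proof.
move=> rs sm dimd; suff gen : forall s1 s2, s = s1 ++ s2 -> Hdim1 (seqM M s2) (size s1).
  exact: (gen [::] s).
move=> s1 s2; elim: s2 s1 => [|y s2 IH] s1 e1.
  by move: dimd; rewrite e1 cats0.
have dimS : Hdim1 (seqM M s2) (size s1).+1.
  by rewrite -(size_rcons s1 y); apply: IH; rewrite cat_rcons.
have [_ yN] : regs M (y :: s2) by move: rs; rewrite e1; elim: (s1) => //= z t IHt [/IHt].
apply: Hdim1_down => //; apply: (@Hvanish_regs (rcons s1 y)); rewrite ?size_rcons //.
  by rewrite cat_rcons -e1.
by move=> z; rewrite /= => zs; apply: sm; rewrite /= e1 -cat_rcons mem_cat zs.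
Qed.

(** The augmentation of the resolution, lifted to [R]: its values [c] on the
    standard basis turn a socle element [u] of [M / N] into the cocycle
    [fun j => c j *: u] of degree zero, and determine [u] up to a unit because the
    augmentation is onto. *)
Lemma residue_coef : exists (c : 'I_(b 0%N) -> R),
  [/\ forall l, m (\sum_j A 0%N l j * c j)
    & exists v : 'I_(b 0%N) -> R, ~ m (\sum_j v j * c j)].
Proof.
case: (km) (resA) => p [psurj pm] [esurj ex _].
have [c pc] := choice (fun j => psurj (e (delta_mx 0 j))).
have ec (v : 'rV_(b 0%N)) : p (\sum_j v 0 j * c j) = e v.
  rewrite {2}[v]row_sum_delta !linear_sum; apply: eq_bigr => j _.
  by rewrite [RHS]linearZ -pc -linearZ.
exists c; split.
  move=> l; apply/pm.
  have := ec (row l (A 0%N)); under eq_bigr do rewrite mxE.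
  by move=> ->; apply/ex; exists (delta_mx 0 l); rewrite -rowE.
have [v ev] := esurj (p 1); exists (v 0) => /pm; rewrite ec ev => /pm.
exact: local1.
Qed.

Lemma socle_cocycle N u c : (forall l, m (\sum_j A 0%N l j * c j)) ->
  (forall y, m y -> N (y *: u)) -> cocycle_mod N 0 (fun j => c j *: u).
Proof.
move=> mc Nu l; rewrite /act; under eq_bigr do rewrite scalerA.
by rewrite -scaler_suml; apply: Nu.
Qed.

Lemma socle_eval N u c (v : 'I_(b 0%N) -> R) : submod N ->
  ~ m (\sum_j v j * c j) -> (forall l, N (c l *: u)) -> N u.
Proof.
move=> sN /(local_unit lm)[a avc] h; rewrite -[u]scale1r -avc -scalerA scaler_suml.
by apply: submodZ => //; apply: submod_sum => // j _; rewrite -scalerA; apply: submodZ.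
Qed.

Lemma Hvanish0_socle N u : submod N -> Hvanish N 0 ->
  (forall y, m y -> N (y *: u)) -> N u.
Proof.
move=> sN van Nu; have [c [mc [v vc]]] := residue_coef.
by apply: (socle_eval sN vc); apply: van; apply: socle_cocycle.
Qed.

Lemma Hdim1_socle N u u' : submod N -> Hdim1 N 0 ->
  (forall y, m y -> N (y *: u)) -> (forall y, m y -> N (y *: u')) -> ~ N u ->
  exists a, N (u' - a *: u).
Proof.
move=> sN dim1 Nu Nu' nNu; have [c [mc [v vc]]] := residue_coef.
have [a [a' [aa h]]] := dim1 _ _ (socle_cocycle mc Nu) (socle_cocycle mc Nu').
have {h} Naa : N (a *: u + a' *: u').
  apply: (socle_eval sN vc) => l; rewrite scalerDr !scalerA ![c l * _]mulrC -!scalerA.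
  exact: h.
have ma' : ~ m a'.
  move=> ma'; apply: nNu; have ma : ~ m a by move=> ma; apply: aa.
  have [d da] := local_unit lm ma; rewrite -[u]scale1r -da -scalerA; apply: submodZ => //.
  by rewrite -[_ *: u](addrK (a' *: u')); apply: submodB => //; apply: Nu'.
have [d da] := local_unit lm ma'; exists (- (d * a)).
rewrite -[u']scale1r -da -!scalerA scaleNr opprK -scalerA -scalerDr addrC.
exact: submodZ.
Qed.

End Coefficients.
End ResidueCohomology.
Arguments cocycle_mod {R b} A {M} N i f.
Arguments coboundary_mod {R b} A {M} N i f.
Arguments Hvanish {R b} A {M} N i.
Arguments Hdim1 {R} m {b} A {M} N i.

(** * A common regular sequence *)

(** Among the submodules spanned by lists [l] of elements with maximal
    annihilators that some [y] in [m] avoids, take a maximal one. If that [y]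
    killed some [u] modulo [N], a maximal annihilator above that of [u] would be
    the annihilator of some [z]; some [x] in [m] kills [l] but not [z], so
    [y + x] avoids [z :: l]. Then [z] is in the span of [l], which [x] kills. *)
Lemma exists_nonzerodiv (R : comNzRingType) (m : set R) (M : lmodType R) (N : set M) :
  noetherian_local m -> noeth M -> submod N ->
  (forall u, (forall y, m y -> N (y *: u)) -> N u) ->
  exists2 y, m y & nonzerodiv_mod N y.
Proof.
move=> lm nM sN soc0.
pose span (l : seq M) := foldr (fun z K => add_span K z) N l.
have sspan l : submod (span l) by elim: l => //= z l IH; apply: submod_add_span.
pose maxann z := forall z', ~ N z' -> colon N z `<=` colon N z' -> colon N z' `<=` colon N z.
pose avoids y (l : seq M) := forall z, z \in l -> maxann z /\ ~ N (y *: z).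
have [||_ [[l [y my yl] <-] lmax]] := nM
  [set span l | l in [set l | exists2 y, m y & avoids y l]].
- by exists N, [::] => //; exists 0; [apply: (submod0 (local_submod lm))|].
- by move=> _ [l _ <-].
exists y => // u Nyu; apply: contrapT => nNu.
have [z [nNz uz zprime zmax]] := maximal_colon (local_noeth lm) sN nNu.
have [x [mx nNxz xl]] : exists x, [/\ m x, ~ N (x *: z) & forall z', z' \in l -> N (x *: z')].
  elim: l yl {lmax} => [_|z' l IH yl].
    apply: contrapT => h; apply: nNz; apply: soc0 => x mx.
    by apply: contrapT => nNxz; apply: h; exists x.
  have [|x [mx nNxz xl]] := IH; first by move=> t tl; apply: yl; rewrite inE tl orbT.
  have [|maxz' nNyz'] := yl z'; first exact: mem_head.
  have [x' Nx'z' nNx'z] : exists2 x', N (x' *: z') & ~ N (x' *: z).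
    apply: contrapT => h; apply: nNyz'; apply: (maxz' z) => //; last exact: uz.
    by move=> c cz'; apply: contrapT => ncz; apply: h; exists c.
  exists (x' * x); split.
  - by apply: (submodZ x' (local_submod lm) mx).
  - by case: zprime => _ _ pr /pr[/nNx'z|/nNxz].
  - move=> t; rewrite inE => /orP[/eqP->|tl].
      by rewrite mulrC -scalerA; apply: submodZ.
    by rewrite -scalerA; apply: submodZ => //; apply: xl.
have xspan v : span l v -> N (x *: v).
  elim: l xl {yl lmax} v => [_ v|t l IH xl v] /=; first exact: submodZ.
  move=> [a [n [ln ->]]]; rewrite scalerDr scalerA mulrC -scalerA; apply: submodD => //.
    by apply: submodZ => //; apply: xl; rewrite mem_head.
  by apply: IH => // t' t'l; apply: xl; rewrite inE t'l orbT.
apply: (nNxz); apply: xspan; apply: (lmax (span (z :: l))).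
- exists (z :: l) => //; exists (y + x); first exact: (submodD (local_submod lm)).
  move=> t; rewrite inE => /orP[/eqP->|tl].
    split=> // Nyxz; apply: nNxz; rewrite -[_ *: z](addKr (y *: z)) -scalerDl.
    by apply: submodD => //; apply: submodN => //; apply: uz.
  have [maxt nNyt] := yl _ tl; split => // Nyxt; apply: nNyt.
  rewrite -[_ *: t](addrK (x *: t)) -scalerDl; apply: submodB => //; exact: xl.
- exact: sub_add_span.
- exact: add_span_gen.
Qed.

Lemma seqM_pair (R : comNzRingType) (M M' : lmodType R) s (u : M) (v : M') :
  seqM (M * M')%type s (u, v) <-> seqM M s u /\ seqM M' s v.
Proof.
elim: s u v => [|y s IH] u v /=.
  by split=> [[-> ->]|[-> ->]].
split=> [[[a c] [[n n'] [/IH[Nn Nn'] [-> ->]]]]|[[a [n [Nn ->]]] [c [n' [Nn' ->]]]]].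
  by split; [exists a, n|exists c, n'].
by exists (a, c), (n, n'); split => //; apply/IH.
Qed.

Lemma regs_pair (R : comNzRingType) (M M' : lmodType R) s :
  regs (M * M')%type s -> regs M s /\ regs M' s.
Proof.
elim: s => //= y s IH [/IH[rM rM'] yr]; split; split=> // u su.
  by have /seqM_pair[] : seqM (M * M')%type s (u, 0);
    rewrite //; apply: yr; apply/seqM_pair; split; rewrite /= ?scaler0 //; apply: submod0.
by have /seqM_pair[] : seqM (M * M')%type s (0, u);
  rewrite //; apply: yr; apply/seqM_pair; split; rewrite /= ?scaler0 //; apply: submod0.
Qed.

Section CommonRegular.
Variables (R : comNzRingType) (m : set R) (k : lmodType R) (b : nat -> nat).
Variables (A : forall i, 'M[R]_(b i.+1, b i)) (e : {linear 'rV[R]_(b 0%N) -> k}).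
Hypotheses (lm : noetherian_local m) (km : residue_module m k).
Hypothesis (resA : free_resolution A e).

Lemma act_fst (M M' : lmodType R) p q (B : 'M[R]_(p, q)) (f : 'I_q -> (M * M')%type) i :
  (act B f i).1 = act B (fun j => (f j).1) i.
Proof. by rewrite /act (raddf_sum fst). Qed.
Lemma act_snd (M M' : lmodType R) p q (B : 'M[R]_(p, q)) (f : 'I_q -> (M * M')%type) i :
  (act B f i).2 = act B (fun j => (f j).2) i.
Proof. by rewrite /act (raddf_sum snd). Qed.

Lemma Hvanish_pair (M M' : lmodType R) i :
  Hvanish A [set 0 : M] i -> Hvanish A [set 0 : M'] i ->
  Hvanish A [set 0 : (M * M')%type] i.
Proof.
move=> van van' f cf.
have /van : cocycle_mod A [set 0 : M] i (fun j => (f j).1).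
  by move=> l; rewrite -act_fst cf.
have /van' : cocycle_mod A [set 0 : M'] i (fun j => (f j).2).
  by move=> l; rewrite -act_snd cf.
case: i f cf {van van'} => [|i] f cf /=.
  by move=> h' h l; rewrite [f l]surjective_pairing h h'.
move=> [g' hg'] [g hg]; exists (fun l => (g l, g' l)) => l.
have := hg l; have := hg' l; rewrite /= => /eqP; rewrite subr_eq0 => /eqP h' /eqP.
rewrite subr_eq0 => /eqP h; apply/eqP; rewrite subr_eq0; apply/eqP.
by rewrite [LHS]surjective_pairing [RHS]surjective_pairing act_fst act_snd h h'.
Qed.

(** A regular sequence exists as soon as the cohomology vanishes in low degrees,
    and this hypothesis, unlike a given regular sequence, is stable under
    products. *)
Lemma exists_regs (M : lmodType R) d : noeth M ->
  (forall i, (i < d)%N -> Hvanish A [set 0 : M] i) ->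
  exists s, [/\ size s = d, [set` s] `<=` m & regs M s].
Proof.
move=> nM van; suff : exists s, [/\ size s = d, [set` s] `<=` m, regs M s
    & forall i, (i < d - d)%N -> Hvanish A (seqM M s) i] by move=> [s [? ? ? _]]; exists s.
elim: {1 3 5}d (leqnn d) => [_|j IH jd].
  by exists [::]; split => // i; rewrite subn0; apply: van.
have [s [sj sm rs vans]] := IH (ltnW jd).
have [|y my yN] := exists_nonzerodiv lm nM (submod_seqM M s).
  by move=> u; apply: (Hvanish0_socle lm km resA) => //; apply: vans; rewrite subn_gt0.
exists (y :: s); split; rewrite /= ?sj //.
  by move=> z; rewrite /= inE => /orP[/eqP->//|]; apply: sm.
move=> i ij; apply: (Hvanish_down resA) => //; apply: vans.
  by apply: leq_trans ij _; apply: leq_sub2l.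
by move: ij; rewrite subnS; case: (d - j)%N.
Qed.

Lemma exists_common_regs (w : lmodType R) s s' : noeth w ->
  regs R^o s -> regs w s' -> [set` s] `<=` m -> [set` s'] `<=` m -> size s = size s' ->
  exists t, [/\ size t = size s, [set` t] `<=` m, regs R^o t & regs w t].
Proof.
move=> nw rs rs' sm sm' ss'.
have [||t [ts tm /regs_pair[rR rw]]] := @exists_regs (R^o * w)%type (size s).
- exact: noeth_pair (local_noeth lm) nw.
- move=> i is_; apply: Hvanish_pair.
    by apply: (@Hvanish_regs _ _ _ _ _ _ lm km resA _ s [::]); rewrite ?cats0.
  by apply: (@Hvanish_regs _ _ _ _ _ _ lm km resA _ s' [::]); rewrite ?cats0 -?ss'.
by exists t.
Qed.

End CommonRegular.

(** * Primes containing a regular sequence *)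

(** An ideal maximal among those containing [I] and avoiding the multiplicative
    set of the [y ^+ n * t] with [t] outside [P]; [I] avoids it as [y] is a
    nonzerodivisor modulo [I]. *)
Lemma smaller_prime (R : comNzRingType) (I P : set R) (y : R) : noeth R^o ->
  submod (I : set R^o) -> nonzerodiv_mod (I : set R^o) y -> prime_ideal P ->
  I `<=` P -> P y ->
  exists Q, [/\ prime_ideal Q, I `<=` Q, Q `<=` P & ~ Q y].
Proof.
move=> nR sI yI [_ P1 Pprime] IP Py.
pose avoid (K : set R) := forall n t, ~ P t -> ~ K (y ^+ n * t).
have [||Q [[sQ IQ avQ] Qmax]] := nR
  [set K | [/\ submod (K : set R^o), I `<=` K & avoid K]].
- exists I; split => //; elim=> [|n IH] t Pt; first by rewrite mul1r => /IP.
  by rewrite exprS -mulrA => /yI; apply: IH.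
- by move=> K [].
have avE a : ~ Q a -> exists n t r q, [/\ ~ P t, Q q & y ^+ n * t = r * a + q].
  move=> Qa; apply: contrapT => h; apply: Qa.
  apply: (Qmax (add_span (Q : set R^o) a)); last 2 first.
  - exact: sub_add_span.
  - exact: add_span_gen.
  split; first exact: submod_add_span.
    by move=> x /IQ; apply: sub_add_span.
  by move=> n t Pt [r [q [Qq eq]]]; apply: h; exists n, t, r, q.
exists Q; split => //.
- split; first exact/ideal_submod.
    by move=> Q1; apply: (avQ 0%N 1) => //; rewrite mulr1.
  move=> a c Qac; apply: contrapT => /not_orP[/avE[n [t [r [q [Pt Qq e1]]]]]].
  move=> /avE[n' [t' [r' [q' [Pt' Qq' e2]]]]].
  apply: (avQ (n + n')%N (t * t')); first by move=> /Pprime[].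
  rewrite exprD mulrACA e1 e2 mulrDl; apply: (submodD sQ).
    rewrite mulrDr; apply: (submodD sQ); last exact: (submodZ (r * a) sQ Qq').
    by rewrite mulrACA; apply: (submodZ (r * r') sQ Qac).
  by rewrite mulrC; apply: (submodZ (r' * c + q') sQ Qq).
- move=> t Qt; apply: contrapT => Pt; apply: (avQ 0%N t) => //.
  by rewrite mul1r.
- by move=> Qy; apply: (avQ 1%N 1) => //; rewrite mulr1 expr1.
Qed.

Lemma regs_prime_chain (R : comNzRingType) (s : seq R) (P : set R) : noeth R^o ->
  regs R^o s -> prime_ideal P -> seqM R^o s `<=` P ->
  exists Q : nat -> set R, [/\ forall i, (i <= size s)%N -> prime_ideal (Q i),
    forall i, (i < size s)%N -> Q i `<` Q i.+1 & Q (size s) = P].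
Proof.
move=> nR; elim: s P => [|y s IH] P /= rs primeP sP; first by exists (fun=> P).
have [rs' yN] := rs.
have Py : P y.
  apply: sP; exists 1, 0; split; first exact: submod0.
  by rewrite addr0 /GRing.scale /= mulr1.
have [|Q [primeQ sQ QP Qy]] := smaller_prime nR (submod_seqM R^o s) yN primeP _ Py.
  by move=> x sx; apply: sP; apply: sub_add_mul.
have [C [primeC ltC Cs]] := IH Q rs' primeQ sQ.
exists (fun i => if (i <= size s)%N then C i else P); split; last by rewrite ltnn.
- by move=> i _; case: ifP => [|_ //]; apply: primeC.
- move=> i; rewrite ltnS => is_; rewrite is_.
  case: ltnP => si; first exact: ltC.
  have -> : i = size s by apply/eqP; rewrite eqn_leq is_ si.
  by rewrite Cs; split => // PQ; apply: Qy; apply: PQ.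
Qed.

(** In dimension [size s], a prime over [s] other than [m] would give a chain of
    length [(size s).+1]. *)
Lemma prime_over_regs (R : comNzRingType) (m : set R) (s : seq R) (P : set R) :
  noetherian_local m -> krull_dim R^o (size s) -> regs R^o s ->
  prime_ideal P -> seqM R^o s `<=` P -> P = m.
Proof.
move=> lm [_ dimR] rs primeP sP.
have [idP P1 _] := primeP.
have Pm : P `<=` m by apply: (proper_sub_local lm) => //; apply/ideal_submod.
apply/seteqP; split => //; apply: contrapT => mP.
have [C [primeC ltC Cs]] := regs_prime_chain (local_noeth lm) rs primeP sP.
have primem : prime_ideal m.
  split; [exact/ideal_submod/(local_submod lm)|exact: local1 lm|].
  move=> x y mxy; have [mx|/(local_unit lm)[z zx]] := pselect (m x); [by left|right].
  by rewrite -[y]mul1r -zx -mulrA; apply: (submodZ z (local_submod lm) mxy).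
have := dimR (size s).+1 (fun i => if (i <= size s)%N then C i else m).
rewrite ltnn => h; suff : false by [].
apply: h; split => i.
  move=> _; have primei : prime_ideal (if (i <= size s)%N then C i else m).
    by case: ifP => // h; apply: primeC.
  split=> // a /(_ 1); rewrite /GRing.scale /= mulr1 => ->.
  by case: primei => -[].
rewrite ltnS => is_; rewrite is_.
case: ltnP => si; first exact: ltC.
have -> : i = size s by apply/eqP; rewrite eqn_leq is_ si.
by rewrite Cs.
Qed.

(** Maximal annihilators are prime, and the only prime over [s] is [m]. *)
Lemma exists_socle (R : comNzRingType) (m : set R) (s : seq R) (M : lmodType R)
    (N : set M) (u : M) :
  noetherian_local m -> krull_dim R^o (size s) -> regs R^o s ->
  submod N -> ~ N u -> (forall a v, seqM R^o s a -> N (a *: v)) ->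
  exists z, ~ N z /\ colon N z = m.
Proof.
move=> lm dimR rs sN Nu sMN.
have [z [Nz _ zprime _]] := maximal_colon (local_noeth lm) sN Nu.
exists z; split => //; apply: (prime_over_regs lm dimR rs zprime) => a sa.
exact: sMN.
Qed.

(** * Ext of cyclic modules from an injective resolution *)

Section IdealModule.
Variables (R : comNzRingType) (I : set R) (sI : submod (I : set R^o)).
Definition ideal_pred of submod (I : set R^o) : {pred R^o} := fun x => `[< I x >].
Fact ideal_pred_closed : submod_closed (ideal_pred sI).
Proof.
split; first exact/asboolP/(submod0 sI).
by move=> a x y /asboolP Ix /asboolP Iy; apply/asboolP; case: sI => _; apply.
Qed.
HB.instance Definition _ :=
  GRing.isSubmodClosed.Build R R^o (ideal_pred sI) ideal_pred_closed.
Record ideal_module := IdealModule { ideal_val : R^o; _ : ideal_val \in ideal_pred sI }.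
HB.instance Definition _ := [isSub for ideal_val].
HB.instance Definition _ := [Choice of ideal_module by <:].
HB.instance Definition _ := [SubChoice_isSubLmodule of ideal_module by <:].
End IdealModule.

(** The easy half of Baer's criterion, for a linear map from an ideal given by
    its graph [T]. *)
Lemma baer (R : comNzRingType) (E : lmodType R) (T : R -> E -> Prop) :
  injective_module E -> T 0 0 ->
  (forall a x y v w, T x v -> T y w -> T (a * x + y) (a *: v + w)) ->
  (forall v, T 0 v -> v = 0) ->
  exists c, forall x v, T x v -> v = x *: c.
Proof.
move=> injE T0 Tlin Tfun.
have sI : submod ([set x | exists v, T x v] : set R^o).
  split; first by exists 0.
  by move=> a x y [v Tv] [w Tw]; exists (a *: v + w); apply: Tlin.
pose U := ideal_module sI.
have valT (u : U) : exists v, T (val u) v by exact/asboolP/(valP u).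
have [f fT] := choice valT.
have Tuniq x v w : T x v -> T x w -> v = w.
  move=> Tv Tw; apply/eqP; rewrite -subr_eq0; apply/eqP; apply: Tfun.
  by have := Tlin (-1) _ _ _ _ Tw Tv; rewrite mulN1r addNr scaleN1r addrC.
have flin : linear f.
  move=> a u v; apply: (Tuniq (val (a *: u + v))) => //; rewrite linearP.
  exact: (Tlin a (val u) (val v)).
pose fL := HB.pack_for {linear U -> E} f (GRing.isLinear.Build R U E *:%R f flin).
have [g gf] := injE U R^o (val : {linear U -> R^o}) fL val_inj.
exists (g 1) => x v Tv.
have Ix : x \in ideal_pred sI by apply/asboolP; exists v.
have := gf (IdealModule Ix) => /= gfx.
have -> : v = f (IdealModule Ix) by exact: (Tuniq x _ _ Tv (fT (IdealModule Ix))).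
by rewrite -[LHS]gfx -linearZ /=; congr (g _); rewrite /GRing.scale /= mulr1.
Qed.

Definition killed (R : comNzRingType) (E : lmodType R) (I : set R) (c : E) :=
  forall a, I a -> a *: c = 0.

(** The maps from the submodule of [R / I] generated by [a], which is
    [R / (I : a)], extend to [R / I]. *)
Lemma lift_killed (R : comNzRingType) (E : lmodType R) (I : set R) (a : R) (c : E) :
  injective_module E -> submod (I : set R^o) -> killed (colon (I : set R^o) a) c ->
  exists c', killed I c' /\ a *: c' = c.
Proof.
move=> injE sI ac.
have [|||c' c'P] := @baer R E
  (fun x v => exists r n, [/\ I n, x = r * a + n & v = r *: c]) injE.
- exists 0, 0; split; rewrite ?scale0r ?mul0r ?addr0 //; exact: (submod0 sI).
- move=> b _ _ _ _ [r [n [In -> ->]]] [r' [n' [In' -> ->]]].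
  exists (b * r + r'), (b * n + n'); split; first by case: sI => _; apply.
    by rewrite mulrDr mulrDl addrACA mulrA.
  by rewrite scalerDl scalerA.
- move=> _ [r [n [In e ->]]]; apply: ac; rewrite /colon /=.
  have -> : r *: (a : R^o) = - n by apply/eqP; rewrite -addr_eq0 /GRing.scale /= -e.
  exact: (submodN sI In).
exists c'; split; last first.
  symmetry; apply: c'P; exists 1, 0; split; rewrite ?mul1r ?addr0 ?scale1r //.
  exact: (submod0 sI).
by move=> n In; symmetry; apply: c'P; exists 0, n; split; rewrite ?mul0r ?add0r ?scale0r.
Qed.

Lemma killed0 (R : comNzRingType) (E : lmodType R) (I : set R) : killed I (0 : E).
Proof. by move=> a _; rewrite scaler0. Qed.

Lemma killedB (R : comNzRingType) (E : lmodType R) (I : set R) (c c' : E) :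
  killed I c -> killed I c' -> killed I (c - c').
Proof. by move=> kc kc' a Ia; rewrite scalerBr kc ?kc' ?subr0. Qed.

Lemma killedP (R : comNzRingType) (E : lmodType R) (I : set R) a (c c' : E) :
  killed I c -> killed I c' -> killed I (a *: c + c').
Proof.
by move=> kc kc' x Ix; rewrite scalerDr kc' // addr0 scalerA mulrC -scalerA kc ?scaler0.
Qed.

Lemma killed_map (R : comNzRingType) (E E' : lmodType R) (I : set R)
    (f : {linear E -> E'}) c : killed I c -> killed I (f c).
Proof. by move=> kc a Ia; rewrite -linearZ kc ?linear0. Qed.

Lemma killedS (R : comNzRingType) (E : lmodType R) (I J : set R) (c : E) :
  I `<=` J -> killed J c -> killed I c.
Proof. by move=> IJ kc a /IJ; apply: kc. Qed.

Lemma killed_add_span (R : comNzRingType) (E : lmodType R) (I : set R) a (c : E) :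
  submod (I : set R^o) ->
  killed (add_span (I : set R^o) a) c <-> killed I c /\ a *: c = 0.
Proof.
move=> sI; split=> [kc|[kc ac] _ [r [n [In ->]]]].
  split; first by apply: killedS kc; apply: sub_add_span.
  by apply: kc; apply: add_span_gen.
by rewrite scalerDl (kc n In) addr0 (_ : r *: (a : R^o) = r * a) // -scalerA ac scaler0.
Qed.

Lemma killed_colon (R : comNzRingType) (E : lmodType R) (I : set R) a (c : E) :
  killed I c -> killed (colon (I : set R^o) a) (a *: c).
Proof. by move=> kc r Ira; rewrite scalerA; apply: kc. Qed.

Lemma add_mul_span (R : comNzRingType) (I : set R) y :
  add_mul (I : set R^o) y = add_span (I : set R^o) y.
Proof.
apply/seteqP; split=> _ [a [n [In ->]]]; exists a, n; split => //;
  by congr (_ + _); apply: mulrC.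
Qed.

Lemma colon_nonzerodiv (R : comNzRingType) (I : set R) y : submod (I : set R^o) ->
  nonzerodiv_mod (I : set R^o) y -> colon (I : set R^o) y = I.
Proof.
move=> sI yI; apply/seteqP; split=> a.
  by rewrite /colon /= => Iay; apply: yI; rewrite /GRing.scale /= mulrC.
by move=> Ia; rewrite /colon /= /GRing.scale /= mulrC; apply: (submodZ y sI Ia).
Qed.

Section InjectiveResolution.
Variables (R : comNzRingType) (M : lmodType R) (E : nat -> lmodType R).
Variables (e : {linear M -> E 0%N}) (d : forall i, {linear E i -> E i.+1}).
Hypotheses (Einj : forall i, injective_module (E i)) (einj : injective e).
Hypotheses (ex0 : forall x, d 0%N x = 0 <-> exists u, e u = x)
  (exS : forall i (x : E i.+1), d i.+1 x = 0 <-> exists y, d i y = x).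
Implicit Types (I J K : set R).

Lemma d_d i (x : E i) : d i.+1 (d i x) = 0.
Proof. by apply/exS; exists x. Qed.

(** The elements of [E i] killed by [I] are the linear maps from [R / I] to
    [E i], so that [Ext^i (R / I, M)] consists of the cocycles killed by [I],
    modulo [ext_bound]. *)
Definition ext_bound I i : E i -> Prop :=
  match i with
  | 0 => fun c => c = 0
  | j.+1 => fun c => exists g, killed I g /\ d j g = c
  end.
Arguments ext_bound : clear implicits.

Definition ext_vanish I i := forall c, killed I c -> d i c = 0 -> ext_bound I i c.

Definition ext_vanish_pred I i := if i is j.+1 then ext_vanish I j else True.

Section LongExact.
Variables (I : set R) (a : R).
Hypothesis sI : submod (I : set R^o).
Local Notation quo := (add_span (I : set R^o) a).
Local Notation sub := (colon (I : set R^o) a).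

(** The next four lemmas are the exactness, in various places, of the long Ext
    sequence of [0 -> R / (I : a) -> R / I -> R / (I + a) -> 0]. *)
Lemma ext_bound_quo i c : ext_vanish_pred sub i -> killed quo c ->
  ext_bound I i c -> ext_bound quo i c.
Proof.
case: i c => [//|i] c van /(killed_add_span _ _ sI)[kc ac] [g [kg dg]].
have : ext_bound sub i (a *: g).
  apply: van; first exact: killed_colon.
  by rewrite linearZ /= dg.
case: i g c van kc ac kg dg => [|i] g c van kc ac kg dg /=.
  by move=> ag; exists g; split => //; apply/killed_add_span.
move=> [g2 [kg2 dg2]]; have [g3 [kg3 ag3]] := lift_killed (@Einj i) sI kg2.
exists (g - d i g3); split; last by rewrite linearB d_d subr0.
apply/killed_add_span => //; split; first by apply: killedB => //; apply: killed_map.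
by rewrite scalerBr -linearZ ag3 dg2 subrr.
Qed.

Lemma ext_vanish_mid i : ext_vanish sub i -> ext_vanish quo i -> ext_vanish I i.
Proof.
move=> vsub vquo c kc dc.
have : ext_bound sub i (a *: c).
  by apply: vsub; [apply: killed_colon|rewrite linearZ /= dc scaler0].
case: i c vsub vquo kc dc => [|i] c vsub vquo kc dc /=.
  by move=> ac; apply: vquo => //; apply/killed_add_span.
move=> [g [kg dg]]; have [g' [kg' ag']] := lift_killed (@Einj i) sI kg.
have [||g2 [kg2 dg2]] := vquo (c - d i g').
- apply/killed_add_span => //; split; first by apply: killedB => //; apply: killed_map.
  by rewrite scalerBr -linearZ ag' dg subrr.
- by rewrite linearB d_d subr0.
exists (g' + g2); split; last by rewrite linearD dg2 addrC subrK.
rewrite -[g']scale1r; apply: killedP => //.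
by move/(killed_add_span _ _ sI): kg2 => [].
Qed.

Lemma ext_lift_cocycle i c : ext_vanish quo i.+1 -> killed sub c -> d i c = 0 ->
  exists c', [/\ killed I c', d i c' = 0 & a *: c' = c].
Proof.
move=> van kc dc; have [c' [kc' ac']] := lift_killed (@Einj i) sI kc.
have [||g [/(killed_add_span _ _ sI)[kg ag] dg]] := van (d i c').
- apply/killed_add_span => //; split; first exact: killed_map.
  by rewrite -linearZ ac' dc.
- exact: d_d.
exists (c' - g); split; first exact: killedB.
  by rewrite linearB dg subrr.
by rewrite scalerBr ag subr0.
Qed.

Lemma ext_vanish_sub i : ext_vanish I i -> ext_vanish quo i.+1 -> ext_vanish sub i.
Proof.
move=> vI vquo c kc dc; have [c' [kc' dc' <-]] := ext_lift_cocycle vquo kc dc.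
have := vI _ kc' dc'.
case: i c c' vI vquo kc dc kc' dc' => [|i] c c' vI vquo kc dc kc' dc' /=.
  by move=> ->; rewrite scaler0.
move=> [g [kg dg]]; exists (a *: g); split; first exact: killed_colon.
by rewrite linearZ /= dg.
Qed.

End LongExact.

(** The kernel of [R / I -> R / J] need not be cyclic, so [J] is reached from [I]
    by adding one generator at a time. *)
Lemma ext_bound_sub I J i c : noeth R^o ->
  submod (I : set R^o) -> submod (J : set R^o) -> I `<=` J ->
  (forall K, submod (K : set R^o) -> I `<=` K -> ext_vanish_pred K i) ->
  killed J c -> ext_bound I i c -> ext_bound J i c.
Proof.
move=> nR sI sJ IJ van kc bc.
have [||K [[sK IK KJ bK] Kmax]] := nR
  [set K | [/\ submod (K : set R^o), I `<=` K, K `<=` J & ext_bound K i c]].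
- by exists I; split.
- by move=> K [].
suff JK : J `<=` K by have -> : J = K by apply/seteqP.
move=> a Ja; apply: (Kmax (add_span (K : set R^o) a)); last 2 first.
- exact: sub_add_span.
- exact: add_span_gen.
have KaJ : add_span (K : set R^o) a `<=` J by apply: add_span_sub.
split => //; first exact: submod_add_span.
  by move=> x /IK; apply: sub_add_span.
apply: ext_bound_quo => //; last exact: killedS kc.
apply: van; first exact: submod_colon.
by move=> x /IK Kx; rewrite /colon /= /GRing.scale /= mulrC; apply: (submodZ a sK Kx).
Qed.

(** [T] relates the elements of [M] to the cocycles representing them: it is the
    graph of an isomorphism from [M / s M] to [Ext^(size s) (R / s, M)], where
    [s] generates [I]. *)
Definition ext_iso (T : M -> forall i, E i -> Prop) s :=
  let I := seqM R^o s in let n := size s in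
  [/\ forall u, exists c, T u n c,
      forall c, killed I c -> d n c = 0 -> exists u, T u n c,
      forall u c, T u n c -> killed I c /\ d n c = 0,
      forall a u v c c', T u n c -> T v n c' -> T (a *: u + v) n (a *: c + c')
    & forall u c, T u n c -> (ext_bound I n c <-> seqM M s u)].

(** The long exact sequence for multiplication by [y] on [R / I], in which both
    outer terms are [R / I] again since [(I : y) = I]. The class related to [u] in
    degree [(size s).+1] is the image [d c] under the connecting map of a [c] for
    which [y *: c] represents [u]. *)
Lemma ext_regs s : regs R^o s -> regs M s ->
  (forall i, i != size s -> ext_vanish (seqM R^o s) i) /\ exists T, ext_iso T s.
Proof.
elim: s => [_ _|y s IH] /=.
  split=> [[//|i] _ c _ /exS[g gc]|].
    by exists g; split => // a ->; rewrite scale0r.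
  exists (fun u i => match i return E i -> Prop with
    0 => fun c => e u = c | _.+1 => fun=> False end); split => /=.
  - by move=> u; exists (e u).
  - by move=> c _ /ex0.
  - move=> u _ <-; split; last by apply/ex0; exists u.
    by move=> a ->; rewrite scale0r.
  - by move=> a u v _ _ <- <-; rewrite linearP.
  - move=> u _ <-; split=> [|->]; last exact: linear0.
    by rewrite -[X in _ = X](linear0 e) => /einj.
move=> [rR yR] [rM yM]; have [van [T [Ttot Tonto Tcoc Tlin Tbd]]] := IH rR rM.
set I := seqM R^o s in van Tonto Tcoc Tbd yR *.
have sI : submod (I : set R^o) by exact: submod_seqM.
have colI : colon (I : set R^o) y = I by apply: colon_nonzerodiv.
rewrite add_mul_span; set I' := @add_span R R^o I y.
have kI' n (c : E n) : killed I' c <-> killed I c /\ y *: c = 0 by apply: killed_add_span.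
have bdI' n (c : E n) : ext_vanish_pred I n -> killed I' c -> ext_bound I n c ->
    ext_bound I' n c.
  by move=> vp; apply: ext_bound_quo; rewrite // colI.
have Tbd0 u : T u (size s) 0 -> seqM M s u.
  move=> Tu; apply/(Tbd _ _ Tu); case: (size s) => [//|n]; exists 0.
  by split; [apply: killed0|apply: linear0].
have TB u v c c' : T u (size s) c -> T v (size s) c' -> T (v - u) (size s) (c' - c).
  move=> Tc Tc'; have := Tlin (-1) _ _ _ _ Tc Tc'.
  by rewrite !scaleN1r ![- _ + _]addrC.
have TZ a u c : T u (size s) c -> T (a *: u) (size s) (a *: c).
  move=> Tc; have T0 := TB _ _ _ _ Tc Tc; have := Tlin a _ _ _ _ Tc T0.
  by rewrite !subrr !addr0.
have vpred : ext_vanish_pred I (size s).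
  by case: (size s) van => [//|n] van /=; apply: van; rewrite neq_ltn ltnSn.
split=> [i isz c /[dup] kc' /kI'[kc yc] dc|].
  have [eis|nis] := eqVneq i (size s); last first.
    apply: bdI' => //; last exact: van.
    case: i c isz kc' kc yc dc nis => [//|i] c isz kc' kc yc dc nis /=.
    by apply: van; rewrite -eqSS.
  move: c kc' kc yc dc; rewrite eis => c kc' kc yc dc; apply: bdI' => //.
  have [u Tu] := Tonto _ kc dc; apply/(Tbd _ _ Tu); apply: yM; apply: Tbd0.
  by have := TZ y _ _ Tu; rewrite yc.
have lift (c : E (size s)) : killed I c -> exists c', killed I c' /\ y *: c' = c.
  by move=> kc; apply: (lift_killed (@Einj _) sI); rewrite colI.
pose T' u i := match i return E i -> Prop with
  | 0 => fun=> False
  | j.+1 => fun c' => exists c, [/\ killed I c, T u j (y *: c) & ext_bound I' j.+1 (c' - d j c)]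
  end.
exists T'; rewrite /ext_iso /= add_mul_span -/I -/I'; split.
- move=> u; have [c Tc] := Ttot u; have [kc dc] := Tcoc _ _ Tc.
  have [c' [kc' yc']] := lift _ kc; exists (d _ c'), c'; split => //; first by rewrite yc'.
  by exists 0; rewrite linear0 subrr; split => //; apply: killed0.
- move=> c' /kI'[kc' yc'] dc'.
  have [|c [kc dc]] := van (size s).+1 _ c' kc' dc'; first by rewrite neq_ltn ltnSn orbT.
  have [||u Tu] := Tonto (y *: c).
  + by move=> a Ia; rewrite scalerA mulrC -scalerA kc ?scaler0.
  + by rewrite linearZ /= dc.
  exists u, c; split => //; exists 0; split; first exact: killed0.
  by rewrite linear0 dc subrr.
- move=> u c' [c [kc Tc [g [kg dg]]]]; have [kyc dyc] := Tcoc _ _ Tc.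
  have -> : c' = d _ (g + c) by rewrite linearD dg subrK.
  split; last exact: d_d.
  rewrite linearD -[d _ g]scale1r; apply: killedP; first exact: killed_map.
  apply/kI'; split; first exact: killed_map.
  by rewrite -linearZ.
- move=> a u v c c' [b [kb Tb [g [kg dg]]]] [b' [kb' Tb' [g' [kg' dg']]]].
  exists (a *: b + b'); split; first exact: killedP.
    rewrite scalerDr scalerA [y * a]mulrC -scalerA; exact: Tlin.
  exists (a *: g + g'); split; first exact: killedP.
  by rewrite !linearP dg dg' /= [RHS]addrACA -scalerDr.
move=> u c' [c [kc Tc [g [kg dg]]]]; split.
  move=> [g' [/kI'[kg' yg'] dg']]; move/kI': kg => [kg yg].
  have [||v Tv] := Tonto (c - (g' - g)).
  + by apply: killedB => //; apply: killedB.
  + by rewrite linearB /= [d _ (g' - g)]linearB dg dg' /= subKr subrr.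
  exists v, (u - y *: v); split; last by rewrite addrC subrK.
  apply: Tbd0; have := TB _ _ _ _ (TZ y _ _ Tv) Tc.
  by rewrite !scalerBr yg' yg !subr0 subrr.
move=> [v [n [Nn eu]]]; have [c1 Tc1] := Ttot v; have [kc1 dc1] := Tcoc _ _ Tc1.
have Tn : T n (size s) (y *: (c - c1)).
  have := TB _ _ _ _ (TZ y _ _ Tc1) Tc; rewrite -scalerBr.
  by rewrite eu addrAC subrr add0r.
suff [b [kb db yb]] : exists b, [/\ killed I b, d _ b = d _ c & y *: b = 0].
  exists (g + b); split; last by rewrite linearD dg db subrK.
  rewrite -[g]scale1r; apply: killedP => //; exact/kI'.
have /(Tbd _ _ Tn) := Nn.
move: c c1 kc kc1 dc1 {Tc Tc1 Tn dg T' van Ttot Tonto Tcoc Tlin Tbd Tbd0 TB TZ vpred lift}.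
case: (size s) => [|j] c c1 kc kc1 dc1 /=.
  move=> yc; exists (c - c1); split => //; first exact: killedB.
  by rewrite linearB dc1 subr0.
move=> [g1 [kg1 dg1]].
have [g2 [kg2 yg2]] : exists g2 : E j, killed I g2 /\ y *: g2 = g1.
  by apply: (lift_killed (@Einj _) sI); rewrite colI.
exists (c - c1 - d j g2); split.
- by apply: killedB; [exact: killedB|exact: killed_map].
- by rewrite !linearB d_d dc1 !subr0.
- by rewrite scalerBr -linearZ yg2 dg1 subrr.
Qed.

End InjectiveResolution.

Lemma seqM_scale (R : comNzRingType) (M : lmodType R) s (a : R) (u : M) :
  seqM R^o s a -> seqM M s (a *: u).
Proof.
elim: s a => [a ->|y s IH a [r [n [In ->]]]] /=; first by rewrite scale0r.
exists (r *: u), (n *: u); split; first exact: IH.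
by rewrite scalerDl scalerA.
Qed.

Section Duality.
Variables (R : comNzRingType) (M : lmodType R) (E : nat -> lmodType R).
Variables (e : {linear M -> E 0%N}) (d : forall i, {linear E i -> E i.+1}).
Hypotheses (Einj : forall i, injective_module (E i)) (einj : injective e).
Hypotheses (ex0 : forall x, d 0%N x = 0 <-> exists u, e u = x)
  (exS : forall i (x : E i.+1), d i.+1 x = 0 <-> exists y, d i y = x).
Variables (n : nat) (m : set R) (s : seq R).
Hypothesis (Efin : forall i, (n < i)%N -> forall x : E i, x = 0).
Hypotheses (lm : noetherian_local m) (dimR : krull_dim R^o (size s)).
Hypotheses (rR : regs R^o s) (rM : regs M s) (Ms : exists u, ~ seqM M s u).
Local Notation I := (seqM R^o s).
Implicit Types J K : set R.

Lemma ext_bound0 J i : ext_bound d J (0 : E i).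
Proof. by case: i => [//|i]; exists 0; split; [exact: killed0|exact: linear0]. Qed.

Lemma ext_vanish1 J i : J 1 -> ext_vanish d J i.
Proof. by move=> J1 c /(_ _ J1); rewrite scale1r => -> _; apply: ext_bound0. Qed.

Lemma regs_proper : ~ I 1.
Proof.
by move=> I1; case: Ms => u; apply; rewrite -[u]scale1r; apply: seqM_scale.
Qed.

Lemma exists_ideal_socle J : submod (J : set R^o) -> I `<=` J -> ~ J 1 ->
  exists z, ~ J z /\ colon (J : set R^o) z = m.
Proof.
move=> sJ IJ J1; apply: (exists_socle lm dimR rR sJ J1) => a v /IJ Ja.
by rewrite /GRing.scale /= mulrC; apply: (submodZ v sJ Ja).
Qed.

(** The modules [R / J] are filtered by copies of the residue field. *)
Lemma ext_vanish_residue i : ext_vanish d m i ->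
  forall J, submod (J : set R^o) -> I `<=` J -> ext_vanish d J i.
Proof.
move=> vm; apply: (noeth_ind (local_noeth lm)) => J sJ IH IJ.
have [J1|J1] := pselect (J 1); first exact: ext_vanish1.
have [z [Jz Jm]] := exists_ideal_socle sJ IJ J1.
apply: (ext_vanish_mid Einj exS (a := z)) => //; first by rewrite Jm.
apply: IH.
- exact: submod_add_span.
- exact: sub_add_span.
- by move=> h; apply: Jz; apply: h; apply: add_span_gen.
- by move=> x /IJ; apply: sub_add_span.
Qed.

Lemma ext_vanish_low i J : (i < size s)%N ->
  submod (J : set R^o) -> I `<=` J -> ext_vanish d J i.
Proof.
have [van _] := ext_regs Einj einj ex0 exS rR rM.
elim: i J => [|i IH] J is_ sJ IJ c kc dc;
  apply: (ext_bound_sub Einj exS (I := I) (local_noeth lm)) => //.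
- by apply: van => //; [rewrite neq_ltn is_|exact: killedS kc].
- by move=> K sK IK; apply: IH => //; apply: ltnW.
- by apply: van => //; [rewrite neq_ltn is_|exact: killedS kc].
Qed.

(** Descending induction from the length of the resolution: the residue field
    embeds in [R / I], for which the vanishing is known. *)
Lemma ext_vanish_high i J : (size s < i)%N ->
  submod (J : set R^o) -> I `<=` J -> ext_vanish d J i.
Proof.
have [van _] := ext_regs Einj einj ex0 exS rR rM.
suff gen k : forall i J, (n < i + k)%N -> (size s < i)%N ->
    submod (J : set R^o) -> I `<=` J -> ext_vanish d J i.
  by apply: (gen n.+1); rewrite addnS ltnS leq_addl.
elim: k {i J} => [|k IH] i J ni si sJ IJ.
  by move=> c _ _; rewrite addn0 in ni; rewrite [c](Efin ni); apply: ext_bound0.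
apply: ext_vanish_residue => //.
have [z [Iz Im]] := exists_ideal_socle (submod_seqM R^o s) (@subset_refl _ _) regs_proper.
rewrite -Im; apply: (ext_vanish_sub Einj exS) => //.
  by apply: van; rewrite neq_ltn si orbT.
apply: IH; rewrite ?addSnnS //; first exact: ltnW.
  exact: submod_add_span.
exact: sub_add_span.
Qed.

(** Write [J = (I : a)]. Each class in [Ext^d (R / J, M)] is [a] times a class of
    [Ext^d (R / I, M) = M / s M], hence zero. If [J] were proper, then
    [Ext^d (R / m, M)] would vanish, as it embeds in [Ext^d (R / J, M)], and so
    would [M / s M]. *)
Lemma regs_quotient_faithful a : (forall u, seqM M s (a *: u)) -> I a.
Proof.
move=> aM; set J := colon (I : set R^o) a.
have [van [T [Ttot Tonto Tcoc Tlin Tbd]]] := ext_regs Einj einj ex0 exS rR rM.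
have sI := submod_seqM R^o s.
have sJ : submod (J : set R^o) by apply: submod_colon.
have IJ : I `<=` J.
  by move=> x Ix; rewrite /J /colon /= /GRing.scale /= mulrC; apply: (submodZ a sI Ix).
have vpred K : submod (K : set R^o) -> I `<=` K -> ext_vanish_pred d K (size s).
  move=> sK IK; have := @ext_vanish_low (size s).-1 K.
  by case: (size s) => //= j; apply.
suff J1 : J 1 by move: J1; rewrite /J /colon /= scale1r.
apply: contrapT => J1.
have vJ : ext_vanish d J (size s).
  move=> c kc dc.
  have [|c' [kc' dc' ac']] := ext_lift_cocycle Einj exS sI _ kc dc.
    apply: ext_vanish_high => //; first exact: submod_add_span.
    exact: sub_add_span.
  have [u Tu] := Tonto _ kc' dc'.
  have Tau : T (a *: u) (size s) (a *: c').
    have := Tlin (-1) _ _ _ _ Tu Tu; rewrite !scaleN1r !addNr => T0.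
    by have := Tlin a _ _ _ _ Tu T0; rewrite !addr0.
  apply: (ext_bound_sub Einj exS (I := I) (local_noeth lm)) => //.
  by rewrite -ac'; apply/(Tbd _ _ Tau).
have Jm : J `<=` m by apply: (proper_sub_local lm).
have sm := local_submod lm.
have vm : ext_vanish d m (size s).
  move=> c kc dc.
  apply: (ext_bound_sub Einj exS (I := J) (local_noeth lm)) => //.
    by move=> K sK JK; apply: vpred => // x /IJ/JK.
  by apply: vJ => //; apply: killedS kc.
case: Ms => u; apply; have [c Tc] := Ttot u; apply/(Tbd _ _ Tc).
have [kc dc] := Tcoc _ _ Tc.
exact: (ext_vanish_residue vm).
Qed.

End Duality.

(** * Endomorphisms *)

Lemma seqM_sub (R : comNzRingType) (M : lmodType R) s (K : set M) :
  submod K -> (forall y v, y \in s -> K (y *: v)) -> seqM M s `<=` K.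
Proof.
move=> sK; elim: s => [_ u ->|y s IH h _ [v [n [Nn ->]]]]; first exact: submod0.
apply: submodD => //; first by apply: h; apply: mem_head.
by apply: IH Nn => z w zs; apply: h; rewrite inE zs orbT.
Qed.

Lemma mem_seqM (R : comNzRingType) (M : lmodType R) s y (v : M) :
  y \in s -> seqM M s (y *: v).
Proof.
elim: s => //= z s IH; rewrite inE => /orP[/eqP->|/IH ys].
  by exists v, 0; rewrite addr0; split => //; apply: submod0.
exact: sub_add_mul.
Qed.

Definition lin_mod (R : comNzRingType) (M : lmodType R) (N : set M) (h : M -> M) :=
  forall a u v, N (h (a *: u + v) - (a *: h u + h v)).

Lemma submod_lin_mod (R : comNzRingType) (M : lmodType R) (N : set M) h :
  submod N -> lin_mod N h -> submod [set u | N (h u)].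
Proof.
move=> sN hl; split=> /= [|a u v Nu Nv].
  have := hl 1 0 0; rewrite !scale1r addr0 opprD addrA subrr add0r.
  by move/(submodN sN); rewrite opprK.
by apply: submodBr (hl a u v) => //; case: sN => _; apply.
Qed.

Lemma lin_defectB (R : comNzRingType) (M : lmodType R) (a : R) (x x' u u' v v' : M) :
  (x - x') - (a *: (u - u') + (v - v')) = (x - (a *: u + v)) - (x' - (a *: u' + v')).
Proof.
rewrite scalerBr [a *: u - _ + _]addrACA -[- (a *: u') - v']opprD.
by rewrite [- (_ - _)]opprD [- (x' - _)]opprD addrACA.
Qed.

Lemma lin_modB (R : comNzRingType) (M : lmodType R) (N : set M) h (r : R) :
  lin_mod N h -> lin_mod N (fun u => h u - r *: u).
Proof.
move=> hl a u v; rewrite lin_defectB scalerDr !scalerA [r * a]mulrC subrr subr0.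
exact: hl.
Qed.

Section SimpleSocle.
Variables (R : comNzRingType) (M : lmodType R) (m : set R) (s : seq R).
Hypotheses (lm : noetherian_local m) (dimR : krull_dim R^o (size s)).
Hypotheses (rR : regs R^o s) (nM : noeth M).
Local Notation I := (seqM R^o s).
Local Notation N0 := (seqM M s).
Hypothesis socle1 : forall u u', (forall y, m y -> N0 (y *: u)) ->
  (forall y, m y -> N0 (y *: u')) -> ~ N0 u -> exists a, N0 (u' - a *: u).
Implicit Types (J : set R) (N : set M).

(** When the socle of [M / s M] is simple, a submodule is determined by its
    annihilator [J]. Enlarge [J] by one element [a] that is a socle element of
    [R / J]: multiplication by [a] maps both the submodule and the elements
    killed by [J] onto the simple socle, so the claim reduces to the kernels of
    [a], whose annihilator is [J + a]. *)
Lemma double_annihilator J : submod (J : set R^o) -> I `<=` J ->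
  forall N, submod N -> (forall a, J a <-> forall u, N u -> N0 (a *: u)) ->
  forall v, (forall a, J a -> N0 (a *: v)) -> N0 `<=` N -> N v.
Proof.
move: J; apply: (noeth_ind (local_noeth lm)) => J sJ IH IJ N sN JN v Jv N0N.
have [J1|J1] := pselect (J 1); first by apply: N0N; rewrite -[v]scale1r; apply: Jv.
have [|a [Ja Jm]] := exists_socle lm dimR rR sJ J1.
  by move=> x t /IJ Jx; rewrite /GRing.scale /= mulrC; apply: (submodZ t sJ Jx).
have s0 := submod_seqM M s.
have yJ y : m y -> J (a * y) by rewrite -Jm mulrC.
have soc u : (forall x, J x -> N0 (x *: u)) -> forall y, m y -> N0 (y *: (a *: u)).
  by move=> Ju y my; rewrite scalerA mulrC; apply: Ju; apply: yJ.
have [n0 Nn0 an0] : exists2 n0, N n0 & ~ N0 (a *: n0).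
  apply: contrapT => h; apply: Ja; apply/JN => u Nu.
  by apply: contrapT => h'; apply: h; exists u.
have NJ u : N u -> forall x, J x -> N0 (x *: u) by move=> Nu x /JN; apply.
have split_n0 u : (forall x, J x -> N0 (x *: u)) ->
    exists c, N0 (a *: (u - c *: n0)) /\ forall x, J x -> N0 (x *: (u - c *: n0)).
  move=> Ju; have [c hc] := socle1 (soc _ (NJ _ Nn0)) (soc _ Ju) an0.
  exists c; split=> [|x Jx]; first by rewrite scalerBr scalerA mulrC -scalerA.
  rewrite scalerBr; apply: submodB => //; first exact: Ju.
  by rewrite scalerA mulrC -scalerA; apply: submodZ => //; apply: NJ.
pose N1 := [set u | N u /\ N0 (a *: u)].
have [c [ac Jc]] := split_n0 _ Jv.
suff : N1 (v - c *: n0).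
  by move=> [Nvc _]; rewrite -(subrK (c *: n0) v); apply: submodD => //; apply: submodZ.
apply: (IH (add_span (J : set R^o) a)).
- exact: submod_add_span.
- exact: sub_add_span.
- by move=> h; apply: Ja; apply: h; apply: add_span_gen.
- by move=> x /IJ; apply: sub_add_span.
- split; first by split; rewrite ?scaler0; apply: submod0.
  move=> r u u' [Nu au] [Nu' au']; split; first by case: sN => _; apply.
  rewrite scalerDr scalerA mulrC -scalerA; apply: submodD => //; exact: submodZ.
- move=> r; split=> [[x [j [Jj ->]]] u [Nu au]|rN1].
    rewrite scalerDl; apply: submodD => //; last by apply: NJ.
    by rewrite -scalerA; apply: submodZ.
  have [||c' hc'] := socle1 (u := a *: n0) (u' := r *: n0) _ _ an0.
  + by apply: soc; apply: NJ.
  + move=> y my; rewrite scalerA mulrC -scalerA; apply: rN1; split; first exact: submodZ.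
    by rewrite scalerA; apply: NJ => //; apply: yJ.
  exists c', (r - c' * a); split; last by rewrite addrC subrK.
  apply/JN => u Nu; have [c'' [ac'' _]] := split_n0 _ (NJ _ Nu).
  rewrite -(subrK (c'' *: n0) u) scalerDr; apply: submodD => //.
    rewrite scalerBl -scalerA; apply: submodB => //; last exact: submodZ.
    apply: rN1; split => //; apply: submodB => //; exact: submodZ.
  rewrite scalerA mulrC -scalerA; apply: submodZ => //.
  by rewrite scalerBl -scalerA.
- move=> _ [r [j [Jj ->]]]; rewrite scalerDl; apply: submodD => //; last exact: Jc.
  by rewrite -scalerA; apply: submodZ.
- move=> u N0u; split; first exact: N0N.
  exact: submodZ.
Qed.

Lemma separate N v : submod N -> N0 `<=` N -> ~ N v ->
  exists r, (forall u, N u -> N0 (r *: u)) /\ ~ N0 (r *: v).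
Proof.
move=> sN N0N Nv; apply: contrapT => h; apply: Nv.
have s0 := submod_seqM M s.
apply: (@double_annihilator [set r | forall u, N u -> N0 (r *: u)]) => //.
- split=> [u _|a x y xN yN u Nu] /=; first by rewrite scale0r; apply: submod0.
  rewrite scalerDl -scalerA; apply: submodD => //; last exact: yN.
  by apply: submodZ => //; apply: xN.
- by move=> a Ia u _; apply: seqM_scale.
by move=> r rN; apply: contrapT => nr; apply: h; exists r.
Qed.

(** A maximal submodule on which [h] is multiplication by some [r] is everything:
    if [z] is a socle element modulo it, correct [r] by a multiple of an element
    that kills the submodule but not [z]. *)
Lemma endo_simple_socle h : lin_mod N0 h -> exists r, forall u, N0 (h u - r *: u).
Proof.
move=> hl; have s0 := submod_seqM M s.
have [||N [[sN N0N [r hr]] Nmax]] := @nM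
  [set N | [/\ submod N, N0 `<=` N & exists r, forall u, N u -> N0 (h u - r *: u)]].
- exists N0; split => //; exists 0 => u N0u; rewrite scale0r subr0.
  have sK := submod_lin_mod s0 hl; apply: (seqM_sub sK) N0u => y v ys /=.
  have := hl y v 0; rewrite addr0 => hyv; apply: submodBr hyv => //.
  by apply: submodD => //; [exact: mem_seqM|exact: (submod0 sK)].
- by move=> N [].
exists r => u; apply: (hr); apply: contrapT => Nu.
have [|z [Nz zm]] := exists_socle lm dimR rR sN Nu.
  by move=> a v Ia; apply: N0N; apply: seqM_scale.
have [r' [r'N r'z]] := separate sN N0N Nz.
have mz y : m y -> N (y *: z) by rewrite -zm.
have gl := lin_modB r hl; set g := fun u => _ in gl.
have sg := submod_lin_mod s0 gl.
have [||c hc] := socle1 (u := r' *: z) (u' := g z) _ _ r'z.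
- by move=> y my; rewrite scalerA mulrC -scalerA; apply: r'N; apply: mz.
- move=> y my; have /(submodN s0) := gl y z 0; rewrite opprB addr0 => hy.
  have : N0 (y *: g z + g 0).
    by apply: submodBr hy => //; apply: hr; apply: mz.
  by move=> hy0; rewrite -[_ *: _](addrK (g 0)); apply: submodB => //; apply: (submod0 sg).
apply: Nz; apply: (Nmax (add_span N z)); last 2 first.
- exact: sub_add_span.
- exact: add_span_gen.
split; [exact: submod_add_span|by move=> x /N0N; apply: sub_add_span|].
exists (r + c * r').
have sg' := submod_lin_mod s0 (lin_modB (c * r') gl).
move=> v /(add_span_sub sg') gv; rewrite scalerDl opprD addrA; apply: gv => /= [t Nt|].
  by apply: submodB => //; [apply: hr|rewrite -scalerA; apply: submodZ => //; apply: r'N].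
by rewrite -scalerA.
Qed.

End SimpleSocle.

Section Descent.
Variables (R : comNzRingType) (M : lmodType R) (m : set R).
Hypotheses (lm : noetherian_local m) (fgM : fin_gen M).

Definition endo_scalar s := forall h, lin_mod (seqM M s) h ->
  exists r, forall u, seqM M s (h u - r *: u).
Definition quotient_faithful s := forall a, (forall u, seqM M s (a *: u)) -> seqM R^o s a.

(** If [h] is multiplication by [r] modulo [y], then [h - r] is [y] times another
    endomorphism, so Nakayama's lemma applies to the endomorphisms, seen through
    their values on finitely many generators. *)
Lemma endo_scalar_descent s y : m y -> nonzerodiv_mod (seqM M s) y ->
  endo_scalar (y :: s) -> endo_scalar s.
Proof.
move=> my yN escal h hl; have sN := submod_seqM M s; set N := seqM M s in yN hl sN *.
have noR : noetherian R by case: lm.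
have [q [p psurj]] := fgM; have nM := noeth_fin_gen noR fgM.
pose gen l := p (delta_mx 0 l).
pose ev (g : M -> M) : {ffun 'I_q -> M} := [ffun l => g (gen l)].
have genP (g : M -> M) : lin_mod N g -> (forall l, N (g (gen l))) -> forall u, N (g u).
  move=> gl gN u; have [v <-] := psurj u; rewrite [v]row_sum_delta linear_sum.
  apply: (submod_sum (N := [set u | N (g u)])); first exact: submod_lin_mod.
  by move=> l _; rewrite linearZ; apply: (submodZ _ (submod_lin_mod sN gl)); apply: gN.
pose H := [set f | exists2 g, lin_mod N g & ev g = f].
pose P := [set f : {ffun 'I_q -> M} | exists r, forall l, N (f l - r *: gen l)].
have sH : submod H.
  split; first exists (fun=> 0) => [a u v|].
  - by rewrite scaler0 addr0 subrr; apply: submod0.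
  - by apply/ffunP => l; rewrite !ffunE.
  move=> a _ _ [g gl <-] [g' gl' <-]; exists (fun u => a *: g u + g' u); last first.
    by apply/ffunP => l; rewrite !ffunE.
  move=> b u v.
  rewrite (_ : _ - _ = a *: (g (b *: u + v) - (b *: g u + g v)) +
    (g' (b *: u + v) - (b *: g' u + g' v))); first by case: sN => _; apply; [exact: gl|exact: gl'].
  rewrite scalerBr addrACA -opprD; congr (_ - _).
  by rewrite !scalerDr !scalerA [b * a]mulrC addrACA.
have sP : submod P.
  split; first by exists 0 => l; rewrite ffunE scale0r subrr; apply: submod0.
  move=> a f f' [r fr] [r' fr']; exists (a * r + r') => l.
  rewrite !ffunE scalerDl opprD addrACA -scalerA -scalerBr.
  by case: sN => _; apply.
suff HP : H `<=` P.
  have [|r hr] := HP (ev h); first by exists h.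
  by exists r; apply: genP (lin_modB r hl) _ => l; have := hr l; rewrite ffunE.
apply: contrapT => /(nakayama lm (noeth_ffun (n := q) nM) sH sP)[Q [sQ HPQ QH HQ mQ]].
apply: HQ => f Hf; have [g gl ef] := Hf.
have [|r hr] := escal g; first by move=> a u v; apply: sub_add_mul; apply: gl.
have [g' /choice[n' hg']] := choice hr.
have gl' : lin_mod N g'.
  move=> a u v; apply: yN.
  rewrite (_ : y *: _ = (g (a *: u + v) - (a *: g u + g v)) -
     (n' (a *: u + v) - (a *: n' u + n' v))).
    apply: (submodB sN); first exact: gl.
    apply: (submodB sN); first by case: (hg' (a *: u + v)).
    by case: sN => _; apply; [case: (hg' u)|case: (hg' v)].
  have yE w : y *: g' w = g w - r *: w - n' w.
    by have [_ ->] := hg' w; rewrite addrK.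
  rewrite scalerBr scalerDr scalerA [y * a]mulrC -scalerA !yE !lin_defectB.
  by rewrite scalerDr !scalerA [r * a]mulrC subrr subr0.
have Qyg' : Q (y *: ev g') by apply: mQ => //; exists g'.
rewrite -(subrK (y *: ev g') f); apply: submodD => //.
apply: HPQ; split.
  by apply: submodB => //; apply: submodZ => //; exists g'.
exists r => l; rewrite -ef !ffunE; have [Nn e] := hg' (gen l).
by rewrite addrAC e addrAC subrr add0r.
Qed.

Lemma quotient_faithful_descent s y : m y -> nonzerodiv_mod (seqM M s) y ->
  quotient_faithful (y :: s) -> quotient_faithful s.
Proof.
move=> my yN qf a0 a0M; have sN := submod_seqM M s.
pose J : set R := [set a | forall u, seqM M s (a *: u)].
have sJ : submod (J : set R^o).
  split=> [u|a x x' Jx Jx' u]; first by rewrite scale0r; apply: submod0.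
  rewrite scalerDl -scalerA; apply: submodD => //; exact: submodZ.
suff JI : J `<=` seqM R^o s by apply: JI.
apply: contrapT => /(nakayama lm (local_noeth lm) sJ (submod_seqM R^o s)).
move=> [Q [sQ JQ QJ nJQ mQ]]; apply: nJQ => a Ja.
have [|b [n [In e]]] := qf a; first by move=> u; apply: sub_add_mul; apply: Ja.
have Jn : J n by move=> u; apply: seqM_scale.
have Jb : J b.
  move=> u; apply: yN; rewrite scalerA; rewrite (_ : y * b = a - n).
    by rewrite scalerBl; apply: submodB.
  by rewrite e addrK.
rewrite e; apply: (submodD sQ); first exact: mQ.
by apply: JQ.
Qed.

Lemma descent s : [set` s] `<=` m -> regs M s ->
  endo_scalar s -> quotient_faithful s -> endo_scalar [::] /\ quotient_faithful [::].
Proof.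
elim: s => [//|y s IH] sm [rM yN] es qf.
have my : m y by apply: sm; rewrite /= mem_head.
apply: IH => //; first by move=> z zs; apply: sm; rewrite /= inE zs orbT.
  exact: endo_scalar_descent es.
exact: quotient_faithful_descent qf.
Qed.

End Descent.

(** * Minors *)

Lemma exists_sorting (s t : nat) (f : 'I_t -> 'I_s) : injective f ->
  exists sigma : 'S_t, {homo f \o sigma : i j / (i < j)%N}.
Proof.
move=> injf; pose T := [tuple f i | i < t]; pose le (x y : 'I_s) := (x <= y)%N.
have [|sigma sigmaE] := @tuple_permP _ _ (sort le T) T _; first by rewrite perm_sort.
exists sigma => i j ij.
have srt : sorted ltn (map val (sort le T)).
  rewrite ltn_sorted_uniq_leq map_inj_uniq ?sort_uniq; last exact: val_inj.
  rewrite sorted_map sort_sorted ?andbT; last by move=> x y; apply: leq_total.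
  by rewrite map_inj_uniq ?enum_uniq.
have fE l : val (f (sigma l)) = nth 0%N (map val (sort le T)) l.
  rewrite (nth_map (f l)) ?size_sort ?size_tuple //.
  by rewrite sigmaE -tnth_nth !tnth_mktuple.
rewrite /= !fE; apply: (sorted_ltn_nth ltn_trans) => //;
  by rewrite inE size_map size_sort size_tuple.
Qed.

Section Minors.
Variables (R : comNzRingType) (s r : nat).
Implicit Type A : 'M[R]_(s, r).

Lemma is_ideal_gen (X : set R) : is_ideal (ideal_gen X).
Proof.
split.
- by move=> I [[I0 _ _] _].
- by move=> x y Ix Iy I [idI XI]; case: (idI) => _ ID _; apply: ID; [apply: Ix|apply: Iy].
- by move=> a x Ix I [idI XI]; case: (idI) => _ _ IM; apply: (IM); apply: Ix.
Qed.

Lemma submod_minors t A : submod (minors_ideal t A : set R^o).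
Proof. by apply/ideal_submod; apply: is_ideal_gen. Qed.

Lemma minor_any_rows t A (f : 'I_t -> 'I_s) (g : 'I_t -> 'I_r) :
  {homo g : i j / (i < j)%N} -> minors_ideal t A (\det (mxsub f g A)).
Proof.
move=> mono_g; have [/injectiveP injf|] := boolP (injectiveb f); last first.
  move=> /injectivePn[i [j ij fij]].
  rewrite (determinant_alternate ij); first exact: (submod0 (submod_minors t A)).
  by move=> l; rewrite !mxE fij.
have [sigma mono_f] := exists_sorting injf.
have -> : \det (mxsub f g A) = (-1) ^+ sigma * \det (mxsub (f \o sigma) g A).
  rewrite (_ : mxsub (f \o sigma) g A = row_perm sigma (mxsub f g A)).
    by rewrite row_permE det_mulmx det_perm mulrA -signr_addb addbb mul1r.
  by apply/matrixP => i j; rewrite !mxE.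
apply: (submodZ _ (submod_minors t A)); apply: sub_gen_smallest.
by exists (f \o sigma), g.
Qed.

(** The part of the Cauchy-Binet formula coming from multilinearity in the rows. *)
Lemma det_mul_rows n l (B : 'M[R]_(n, l)) (D : 'M[R]_(l, n)) :
  \det (B *m D) = \sum_(h : {ffun 'I_n -> 'I_l}) (\prod_i B i (h i)) * \det (rowsub h D).
Proof.
transitivity (\sum_(h : {ffun 'I_n -> 'I_l}) \sum_(sigma : 'S_n)
    (-1) ^+ sigma * \prod_i (B i (h i) * D (h i) (sigma i))).
  rewrite exchange_big; apply: eq_bigr => /= sigma _; rewrite -big_distrr /=.
  congr (_ * _); rewrite -(bigA_distr_bigA (fun i j => B i j * D j (sigma i))) /=.
  by apply: eq_bigr => x _; rewrite mxE.
apply: eq_bigr => h _; rewrite big_distrr /=; apply: eq_bigr => sigma _.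
rewrite mulrCA big_split /=; congr (_ * (_ * _)).
by apply: eq_bigr => x _; rewrite mxE.
Qed.

End Minors.

Lemma lift_mono n (j : 'I_n.+1) : {homo lift j : i i' / (i < i')%N}.
Proof. by move=> i i'; rewrite /= !ltnNge leq_bump2. Qed.

(** In each maximal minor of [v] on top of [A], expand along the row [v] if it
    occurs; a row occurring twice gives [0]. *)
Lemma det_col_mx_minors (R : comNzRingType) s t (A : 'M[R]_(s, t.+1)) (v : 'M[R]_(1, t.+1))
    (h : 'I_t.+1 -> 'I_(1 + s)) :
  minors_ideal t A (\det (rowsub h (col_mx v A))).
Proof.
have sI := submod_minors t A.
have [/injectiveP injh|] := boolP (injectiveb h); last first.
  move=> /injectivePn[i [j ij hij]].
  rewrite (determinant_alternate ij); first exact: (submod0 sI).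
  by move=> l; rewrite !mxE hij.
have [i0 /choice[f hf]] : exists i0, forall i, exists i', h (lift i0 i) = rshift 1 i'.
  have [[i0 h0]|h0] := pselect (exists i0, h i0 = lshift s ord0).
    exists i0 => i; case: (splitP (h (lift i0 i))) => [z hz|i' hi'].
      have : h (lift i0 i) = h i0 by rewrite h0; apply: val_inj; rewrite /= hz ord1.
      by move/injh/eqP; rewrite eq_sym (negbTE (neq_lift _ _)).
    by exists i'; apply: val_inj.
  exists ord0 => i; case: (splitP (h (lift ord0 i))) => [z hz|i' hi'].
    by case: h0; exists (lift ord0 i); apply: val_inj; rewrite /= hz ord1.
  by exists i'; apply: val_inj.
rewrite (expand_det_row _ i0); apply: (@submod_sum R R^o _ _ _ _ _ sI) => j _.
apply: (submodZ _ sI); apply: (submodZ _ sI).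
rewrite (_ : row' _ _ = mxsub f (lift j) A); first by apply: minor_any_rows; apply: lift_mono.
apply/matrixP => i j'; rewrite !mxE hf.
by case: split_ordP => z /eqP; rewrite eq_shift // => /eqP ->.
Qed.

(** * Radicals *)

Lemma submod_radical (R : comNzRingType) (I : set R) :
  submod (I : set R^o) -> submod (radical I : set R^o).
Proof.
move=> sI; split; first by exists 1%N; rewrite expr1; apply: (submod0 sI).
move=> a x y [n Ixn] [n' Iyn']; exists (n + n')%N.
have IM b z : I z -> I (b * z) by move=> Iz; apply: (submodZ b sI Iz).
rewrite exprDn; apply: (@submod_sum R R^o _ _ _ _ _ sI) => i _; rewrite -mulr_natl; apply: (IM).
have [le|lt] := leqP n' i; first by rewrite -(subnK le) exprD mulrA; apply: (IM).
rewrite mulrC; apply: (IM); rewrite /GRing.scale /= exprMn; apply: (IM).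
by rewrite -addnBA ?(ltnW lt) // addnC exprD; apply: (IM).
Qed.

Lemma radical_sub (R : comNzRingType) (I J : set R) :
  I `<=` radical J -> radical I `<=` radical J.
Proof. by move=> IJ x [n /IJ[n' Jx]]; exists (n * n')%N; rewrite exprM. Qed.

(** * Traces and Fitting ideals *)

Section TraceFitting.
Variables (R : comNzRingType) (w : lmodType R).

Lemma is_ideal_trace : is_ideal (trace_ideal w).
Proof.
split.
- by exists 0%N, (fun=> \0), (fun=> 0); rewrite big_ord0.
- move=> _ _ [n [phi [u ->]]] [n' [phi' [u' ->]]].
  exists (n + n')%N, (fun i => match split i with inl j => phi j | inr j => phi' j end),
    (fun i => match split i with inl j => u j | inr j => u' j end).
  rewrite big_split_ord; congr (_ + _); apply: eq_bigr => i _.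
    by rewrite (unsplitK (inl i)).
  by rewrite (unsplitK (inr i)).
- move=> a _ [n [phi [u ->]]]; exists n, phi, (fun i => a *: u i).
  by rewrite mulr_sumr; apply: eq_bigr => i _; rewrite linearZ.
Qed.

Lemma pres_row s r (A : 'M[R]_(s, r)) (p : {linear 'rV[R]_r -> w}) i :
  free_presentation A p -> \sum_j A i j *: p (delta_mx 0 j) = 0.
Proof.
move=> [_ kerp]; have : p (row i A) = 0 by apply/kerp; exists (delta_mx 0 i); rewrite -rowE.
by rewrite [row i A]row_sum_delta linear_sum => {2}<-; apply: eq_bigr => j _; rewrite linearZ mxE.
Qed.

(** Cramer's rule for the relations that express all generators but one. *)
Lemma minor_cyclic s t (A : 'M[R]_(s, t.+1)) (p : {linear 'rV[R]_t.+1 -> w})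
    (f : 'I_t -> 'I_s) (g : 'I_t -> 'I_t.+1) :
  free_presentation A p -> injective g ->
  exists u0 : w, forall u : w, exists c, \det (mxsub f g A) *: u = c *: u0.
Proof.
move=> pres injg; pose gen j := p (delta_mx 0 j); set B := mxsub f g A.
pose S := [set g j | j : 'I_t]%SET.
have [i0 Di0] : exists i0, (~: S)%SET = [set i0]%SET.
  apply/cards1P; rewrite -(eqn_add2l #|S|) cardsC card_imset // !card_ord.
  by rewrite addn1.
have Si0 j : (j \in S) = (j != i0).
  by rewrite -[S]finset.setCK finset.in_setC Di0 inE.
exists (gen i0) => u; have [v <-] := pres.1 u.
pose b i := - A (f i) i0.
have rel i : act B (gen \o g) i = b i *: gen i0.
  have := pres_row (f i) pres; rewrite (bigD1 i0) //= => /eqP; rewrite addrC addr_eq0 => /eqP.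
  rewrite /b scaleNr => <-; rewrite -(eq_bigl _ _ Si0) big_imset; last first.
    by move=> ? ? _ _; apply: injg.
  by apply: eq_big => [j|j _]; rewrite ?mxE.
have cyc j : exists c, \det B *: gen j = c *: gen i0.
  have [->|] := eqVneq j i0; first by exists (\det B).
  rewrite -Si0 => /imsetP[l _ ->]; exists (\sum_k \adj B l k * b k).
  rewrite -[LHS](act_scalar _ (gen \o g)) -mul_adj_mx act_mul scaler_suml.
  by rewrite /act; apply: eq_bigr => k _; rewrite [X in _ *: X]rel scalerA.
have /choice[c hc] := cyc.
exists (\sum_j v 0 j * c j); rewrite {1}[v]row_sum_delta linear_sum scaler_sumr scaler_suml.
by apply: eq_bigr => j _; rewrite linearZ scalerA mulrC -scalerA [_ *: p _]hc scalerA.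
Qed.

(** When [w] is faithful, a multiple of [w] inside a cyclic submodule gives a
    well-defined map to [R]. *)
Lemma trace_of_cyclic (delta : R) (u0 : w) :
  (forall a : R, (forall u : w, a *: u = 0) -> a = 0) ->
  (forall u : w, exists c, delta *: u = c *: u0) -> trace_ideal w (delta ^+ 2).
Proof.
move=> faith /choice[c hc].
have uniq x : x *: u0 = 0 -> delta * x = 0.
  move=> xu0; apply: faith => u; rewrite mulrC -scalerA hc scalerA mulrC -scalerA.
  by rewrite xu0 scaler0.
have philin : linear (fun u => delta * c u : R^o).
  move=> a u v; apply/eqP; rewrite -subr_eq0; apply/eqP.
  rewrite /GRing.scale /= mulrCA -mulrDr -mulrBr; apply: uniq.
  by rewrite scalerBl scalerDl -scalerA -!hc scalerDr !scalerA mulrC subrr.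
pose phi := HB.pack_for {linear w -> R^o} (fun u => delta * c u : R^o)
  (GRing.isLinear.Build R w R^o *:%R (fun u => delta * c u : R^o) philin).
exists 1%N, (fun=> phi), (fun=> u0); rewrite big_ord1 /=.
apply/eqP; rewrite -subr_eq0 expr2 -mulrBr; apply/eqP; apply: uniq.
by rewrite scalerBl hc subrr.
Qed.

(** The endomorphism [phi _ *: u] is a scalar [r]; comparing the values under
    [phi] gives [phi u ^+ 2 = r * phi u]. *)
Lemma square_cyclic (phi : {linear w -> R^o}) (u : w) : @endo_scalar R w [::] ->
  forall x, exists c, (phi u ^+ 2) *: x = c *: u.
Proof.
move=> endo; have [|r hr] := endo (fun x => phi x *: u).
  by move=> a x y /=; rewrite linearP scalerDl -scalerA subrr.
have hr' x : phi x *: u = r *: x by apply/eqP; rewrite -subr_eq0 hr.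
have ra : phi u ^+ 2 = r * phi u.
  by have := congr1 phi (hr' u); rewrite !linearZ.
by move=> x; exists (phi u * phi x); rewrite ra mulrC -scalerA -hr' scalerA.
Qed.

(** The hypothesis says that [a%:M] factors through the matrix with [v] on top of
    [A], where [v] lifts [u]; take determinants. *)
Lemma power_in_minors s t (A : 'M[R]_(s, t.+1)) (p : {linear 'rV[R]_t.+1 -> w}) (a : R) (u : w) :
  free_presentation A p -> (forall x : w, exists c, a *: x = c *: u) ->
  minors_ideal t A (a ^+ t.+1).
Proof.
move=> [psurj kerp] /choice[c hc]; have [v pv] := psurj u.
pose C : 'cV[R]_t.+1 := \col_j c (p (delta_mx 0 j)).
have [|W WA] := @row_lift R _ _ _ (a%:M - C *m v) A.
  move=> i; apply/kerp; rewrite [row i _]linearB /= row_mul linearB /=.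
  rewrite -scalemx1 [row i (a *: _)]linearZ /= row1 linearZ /= hc.
  by rewrite [row i C]mx11_scalar mul_scalar_mx linearZ /= pv !mxE subrr.
have -> : a ^+ t.+1 = \det (row_mx C W *m col_mx v A).
  by rewrite mul_row_col WA addrC subrK det_scalar.
have sI := submod_minors t A.
rewrite det_mul_rows; apply: (@submod_sum R R^o _ _ _ _ _ sI) => h _.
by apply: (submodZ _ sI); apply: det_col_mx_minors.
Qed.
End TraceFitting.

(** * The canonical module *)

Lemma krull_dim_unique (R : comNzRingType) (M : lmodType R) d d' :
  krull_dim M d -> krull_dim M d' -> d = d'.
Proof.
move=> [[P Pd] dmax] [[P' Pd'] dmax']; apply/eqP.
by rewrite eqn_leq (dmax' _ _ Pd) (dmax _ _ Pd').
Qed.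

Lemma depth_unique (R : comNzRingType) (m : set R) (M : lmodType R) t t' :
  depth m M t -> depth m M t' -> t = t'.
Proof.
move=> [[s [rs sm st]] tmax] [[s' [rs' sm' st']] tmax']; apply/eqP.
by rewrite eqn_leq -{1}st -{2}st' tmax ?tmax'.
Qed.

Section ExtResidue.
Variables (R : comNzRingType) (M : lmodType R) (b : nat -> nat).
Variable A : forall i, 'M[R]_(b i.+1, b i).

Definition row_comb q (f : 'I_q -> M) (v : 'rV[R]_q) := \sum_j v 0 j *: f j.
Fact row_comb_linear q (f : 'I_q -> M) : linear (row_comb f).
Proof.
move=> a u v; rewrite /row_comb scaler_sumr -big_split; apply: eq_bigr => j _.
by rewrite !mxE scalerDl scalerA.
Qed.
HB.instance Definition _ q (f : 'I_q -> M) :=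
  GRing.isLinear.Build R 'rV[R]_q M *:%R (row_comb f) (row_comb_linear f).

Lemma row_comb_delta q (f : 'I_q -> M) l : row_comb f (delta_mx 0 l) = f l.
Proof.
rewrite /row_comb (bigD1 l) //= big1 ?addr0 ?mxE ?eqxx ?scale1r // => j jl.
by rewrite mxE eqxx (negbTE jl) scale0r.
Qed.

Lemma linear_act p q (B : 'M[R]_(p, q)) (g : {linear 'rV[R]_q -> M}) l :
  g (row l B) = act B (fun j => g (delta_mx 0 j)) l.
Proof.
rewrite [row l B]row_sum_delta linear_sum; apply: eq_bigr => j _.
by rewrite linearZ mxE.
Qed.

Lemma cocycle_row_comb i (f : 'I_(b i) -> M) :
  cocycle_mod A [set 0] i f -> cocycle A (row_comb f).
Proof.
move=> cf v; rewrite [v]row_sum_delta mulmx_suml linear_sum big1 // => l _.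
rewrite -scalemxAl linearZ -rowE /= linear_act.
rewrite (_ : (fun j => _) = f); last by apply: funext => j; apply: row_comb_delta.
by rewrite cf scaler0.
Qed.

Lemma cocycle_delta i (f : {linear 'rV[R]_(b i) -> M}) :
  cocycle A f -> cocycle_mod A [set 0] i (fun l => f (delta_mx 0 l)).
Proof. by move=> cf l; rewrite -linear_act rowE; apply: cf. Qed.

Lemma coboundary_delta i (h : 'rV[R]_(b i) -> M) :
  coboundary A h -> coboundary_mod A [set 0] i (fun l => h (delta_mx 0 l)).
Proof.
case: i h => [|i] h /= => [h0 l|[g hg]]; first exact: h0.
by exists (fun j => g (delta_mx 0 j)) => l; rewrite hg -rowE linear_act subrr.
Qed.

End ExtResidue.

(** If two classes have coefficients [c] and [c'] on the generator of
    [Ext^t (k, M)], then [c'] and [- c] give a relation between them, unless both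
    lie in [m]; then both classes vanish. *)
Lemma ext_residue_Hdim1 (R : comNzRingType) (m : set R) (M : lmodType R) t :
  noetherian_local m -> ext_residue_dim m M t 1 ->
  exists (k : lmodType R) (b : nat -> nat) (A : forall i, 'M[R]_(b i.+1, b i))
    (e : {linear 'rV[R]_(b 0%N) -> k}),
    [/\ residue_module m k, free_resolution A e & Hdim1 m A [set 0 : M] t].
Proof.
move=> lm [k [b [A [e [f [km resA cf fgen _]]]]]]; exists k, b, A, e; split => //.
have s0 := submod_set0 M.
pose f0 l := f ord0 (delta_mx 0 l).
have gen g : cocycle_mod A [set 0] t g ->
    exists c, coboundary_mod A [set 0] t (fun l => g l - c *: f0 l).
  move=> /cocycle_row_comb/fgen[c /coboundary_delta h]; exists (c ord0).
  rewrite (_ : (fun l => _) = (fun l => row_comb g (delta_mx 0 l) -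
    \sum_j c j *: f j (delta_mx 0 l))) //.
  by apply: funext => l; rewrite big_ord1 row_comb_delta.
move=> g g' cg cg'; have [c hc] := gen _ cg; have [c' hc'] := gen _ cg'.
have [[mc mc']|ncc] := pselect (m c /\ m c').
  exists 1, 0; split; first by move=> [/(local1 lm)].
  have := coboundary_mod_lin 1 s0 hc
    (coboundary_mod_kill lm km resA s0 mc (cocycle_delta (cf ord0))).
  by congr (coboundary_mod _ _ _ _); apply: funext => l; rewrite !scale1r subrK scale0r addr0.
exists c', (- c); split.
  move=> [mc' /(submodN (local_submod lm))]; rewrite opprK => mc.
  exact: ncc.
have := coboundary_mod_lin (- c) s0 hc' (coboundary_mod_lin c' s0 hc (coboundary_mod0 A t s0)).
congr (coboundary_mod _ _ _ _); apply: funext => l.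
rewrite addr0 !scalerBr !scalerA !scaleNr mulNr scaleNr opprK [c' * c]mulrC.
by rewrite addrACA subrr addr0 addrC.
Qed.

(** This collects the argument for [R = End w]: a common regular sequence [s] of
    length [dim R], the two claims modulo [s], and the descent from [s] to the
    empty sequence. *)
Lemma canonical_endo (R : comNzRingType) (m : set R) (w : lmodType R) :
  CM_local_ring m -> canonical_module m w ->
  @endo_scalar R w [::] /\ @quotient_faithful R w [::].
Proof.
move=> [lm [_ [d [[sR [rsR sRm <-]] _] dimR]]].
move=> [[[fgw [dw depw dimw]] [d' dimw' dimR']] [t dept ext1]].
move=> [n [E [e [dE [Einj Efin einj ex0 exS]]]]].
rewrite (krull_dim_unique dimR' dimR) in dimw'.
rewrite (krull_dim_unique dimw dimw') {dw dimw dimw' dimR'} in depw.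
rewrite (depth_unique dept depw) in ext1.
have [[sw [rsw swm swd]] _] := depw.
have nw : noeth w by apply: noeth_fin_gen fgw; case: lm.
have [k [b [A [f [km resA dim1]]]]] := ext_residue_Hdim1 lm ext1.
have mrev (s : seq R) : [set` s] `<=` m -> [set` rev s] `<=` m.
  by move=> sm y /=; rewrite mem_rev; apply: sm.
have [|s [ss sm rR rw]] := exists_common_regs lm km resA nw (regular_seq_regs rsR)
  (regular_seq_regs rsw) (mrev _ sRm) (mrev _ swm); first by rewrite !size_rev swd.
rewrite size_rev in ss; rewrite -ss in dimR dim1.
have Ms : exists u, ~ seqM w s u.
  apply: contrapT => h; have [_ [u su]] := rsw.
  have [|||Q [sQ _ _ nQ mQ]] := @nakayama R m lm w setT [set 0] nw.
  - by split.
  - exact: submod_set0.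
  - by move=> /(_ u I) u0; apply: su; rewrite u0 seq_mul_seqM; apply: submod0.
  apply: nQ => v _; apply: (seqM_sub (s := s) sQ).
    by move=> y x ys; apply: mQ => //; apply: sm.
  by apply: contrapT => nsv; apply: h; exists v.
apply: (descent lm fgw sm rw).
- apply: (endo_simple_socle lm dimR rR nw) => u u' su su' nu.
  apply: (Hdim1_socle lm km resA (submod_seqM w s)) su su' nu.
  exact: (Hdim1_regs lm km resA rw sm dim1).
- exact: (regs_quotient_faithful Einj einj ex0 exS Efin lm dimR rR rw Ms).
Qed.

Theorem corollary2p2 (R : comNzRingType) (m : set R) (w : lmodType R) :
  CM_local_ring m -> canonical_module m w ->
  radical (Fitt 1 w) = radical (trace_ideal w).
Proof.
move=> CMR can; have lm : noetherian_local m by case: CMR.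
have noR : noetherian R by case: lm.
have fgw : fin_gen w by case: can => -[[]].
have [es qf] := canonical_endo CMR can.
have faith (a : R) : (forall u : w, a *: u = 0) -> a = 0 by move=> /qf.
have [s [r [A [p [pres ->]]]]] : exists s r (A : 'M[R]_(s, r)) (p : {linear 'rV[R]_r -> w}),
    free_presentation A p /\ Fitt 1 w = minors_ideal (r - 1) A.
  have [s [r [A [p pres]]]] := finite_presentation noR fgw.
  apply: (@xgetPex _ set0 [set I | exists s r (A : 'M[R]_(s, r)) (p : {linear 'rV[R]_r -> w}),
    free_presentation A p /\ I = minors_ideal (r - 1) A]).
  by exists (minors_ideal (r - 1) A), s, r, A, p.
case: r A p pres => [|t] A p pres.
  have /eqP := oner_neq0 R; case; apply: faith => u; have [v <-] := pres.1 u.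
  by rewrite [v]thinmx0 !linear0.
rewrite subn1 /=; have strace := proj1 (ideal_submod _) (is_ideal_trace w).
apply/seteqP; split; apply: radical_sub.
- apply: smallest_sub; first by apply/ideal_submod/submod_radical.
  move=> _ [f [g [_ mono_g ->]]].
  have injg : injective g.
    move=> i j gij; apply: contrapT => /eqP; rewrite neq_ltn.
    by move=> /orP[] /mono_g; rewrite gij ltnn.
  have [u0 hu0] := minor_cyclic f pres injg.
  by exists 2; apply: trace_of_cyclic faith hu0.
- move=> _ [n [phi [u ->]]].
  apply: (@submod_sum R R^o _ _ _ _ _ (submod_radical (submod_minors t A))) => i _.
  exists (2 * t.+1)%N; rewrite exprM; apply: power_in_minors pres _.
  exact: square_cyclic.
Qed.
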